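(* Let $(\mathcal S,\mathcal Q,\Theta)$ be a Pufferfish scenario, $f:\mathcal X\to\mathbb R^d$ a query, and $\omega$ a continuous slice distribution on $\mathbb S^{d-1}$. Draw i.i.d. directions $U_1,\dots,U_m\sim\omega$. Assume $0\le\Delta^u_\infty\le\Delta_0$ for all $u$. Fix $\alpha>1$, $\varepsilon>0$, $\gamma\in(0,1)$. Let $\widehat\Delta_\infty(U_\ell)$, $\ell\in[m]$, be random quantities satisfying $\Pr(\Delta^{U_\ell}_\infty\le\widehat\Delta_\infty(U_\ell)\text{ for all }\ell\in[m])\ge1-\gamma/2$, where the probability is over the conditional sampling used to form the $\widehat\Delta_\infty(U_\ell)$. If the Gaussian mechanism uses $N\sim\mathcal N(0,\sigma^2I_d)$ (independent of $X$) with \[ \sigma^2\ge\frac{\alpha}{2\varepsilon}\left(\frac1m\sum_{\ell=1}^m(\widehat\Delta_\infty(U_\ell))^2+\Delta_0^2\sqrt{\frac{\log(4/\gamma)}{2m}}\right), \] then with probability at least $1-\gamma$ (over both the conditional sampling and the draw of $U_{1:m}$), $\mathcal M(X)=f(X)+N$ satisfies $(\alpha,\varepsilon,\omega)$-Ave-SRPP in $(\mathcal S,\mathcal Q,\Theta)$.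
   Context: Pufferfish scenario: secrets $\mathcal S$, pairs $\mathcal Q\subseteq\mathcal S\times\mathcal S$, priors $\Theta$; each $\theta$ is a joint law of secret $S$ and dataset $X$, with secret marginal $P^S_\theta$. $P^{f,s}_\theta$ is the law of $f(X)$ given $S=s$ under $\theta$; $\mathcal M^\theta_s$ the law of $\mathcal M(X)$ given $S=s$ under $\theta$. $\mathbb S^{d-1}$ is the unit sphere, $\Psi^u(a)=\langle a,u\rangle$, $\Psi^u_\#$ pushforward. $W_\infty(\nu,\mu)=\inf_{\pi\in\Pi(\nu,\mu)}\sup_{(x,y)\in\mathrm{supp}\,\pi}|x-y|$ for measures on $\mathbb R$. $\Delta^u_\infty:=\max_{(s_i,s_j)\in\mathcal Q,\theta\in\Theta}W_\infty(\Psi^u_\#P^{f,s_i}_\theta,\Psi^u_\#P^{f,s_j}_\theta)$. $\mathtt D_\alpha$ is R\'enyi divergence; $\mathtt{AveSD}^\omega_\alpha(P\|Q)=\int\mathtt D_\alpha(\Psi^u_\#P\|\Psi^u_\#Q)\,d\omega(u)$. $\mathcal M$ is $(\alpha,\varepsilon,\omega)$-Ave-SRPP in $(\mathcal S,\mathcal Q,\Theta)$ if $\mathtt{AveSD}^\omega_\alpha(\mathcal M^\theta_{s_i}\|\mathcal M^\theta_{s_j})\le\varepsilon$ for all $\theta\in\Theta$ and $(s_i,s_j)\in\mathcal Q$ with $P^S_\theta(s_i),P^S_\theta(s_j)>0$. *)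

(* Defs.v *)
From HB Require Import structures.
From mathcomp Require Import all_boot all_order all_algebra.
From mathcomp Require Import all_classical all_reals all_analysis.
Import Order.TTheory GRing.Theory Num.Theory.

Set Implicit Arguments.
Unset Strict Implicit.
Unset Printing Implicit Defensive.

Local Open Scope classical_set_scope.
Local Open Scope ring_scope.

(* R^d as row vectors, with the Borel sigma-algebra (generated by the   *)
(* coordinate maps; for finite d this is the Borel sigma-algebra).      *)
Definition vecR (R : realType) (d : nat) := 'rV[R]_d.
HB.instance Definition _ (R : realType) d := Choice.on (vecR R d).
HB.instance Definition _ (R : realType) d := isPointed.Build (vecR R d) 0.

Definition coord_sets (R : realType) (d : nat) : set (set (vecR R d)) :=
  [set B | exists (i : 'I_d) (A : set R),
      measurable A /\ B = (fun v : 'rV[R]_d => v ord0 i) @^-1` A].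

Definition Rd (R : realType) (d : nat) := g_sigma_algebraType (@coord_sets R d).

Definition dotv (R : realType) (d : nat) (a u : 'rV[R]_d) : R :=
  \sum_(i < d) a ord0 i * u ord0 i.
Definition normv (R : realType) (d : nat) (a : 'rV[R]_d) : R :=
  Num.sqrt (dotv a a).
Definition sphere (R : realType) (d : nat) : set (Rd R d) :=
  [set u | normv (u : 'rV[R]_d) = 1].

(* Pufferfish: a prior theta is a joint law of (S, X) on S * X.          *)
Section pufferfish.
Context (R : realType) (d : nat) (dS dX : measure_display)
  (S : measurableType dS) (X : measurableType dX).

Definition smass (theta : probability (S * X)%type R) (s : S) : \bar R :=
  theta ([set s] `*` setT).

Definition cond_proj_law (theta : probability (S * X)%type R)
  (f : X -> 'rV[R]_d) (s : S) (u : Rd R d) : set R -> \bar R :=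
  fun B => (fine (theta ([set s] `*` [set x | B (dotv (f x) (u : 'rV[R]_d))]))
            / fine (smass theta s))%:E.

(* Psi^u_# M^theta_s for the mechanism M(X) = f(X) + N, where N is defined
   on its own probability space (OmN, PN), hence independent of (S, X):
   law of <f(X) + N, u> given S = s under theta (x) PN *)
Definition mech_proj_law (dN : measure_display) (OmN : measurableType dN)
  (f : X -> 'rV[R]_d) (PN : probability OmN R) (N : OmN -> 'rV[R]_d)
  (theta : probability (S * X)%type R) (s : S) (u : Rd R d) : set R -> \bar R :=
  fun B => (fine (product_measure1 theta PN
                    [set z | z.1.1 = s /\ B (dotv (f z.1.2 + N z.2) (u : 'rV[R]_d))])
            / fine (smass theta s))%:E.

End pufferfish.

Section winf.
Context (R : realType).

Definition is_coupling (pi : probability (R * R)%type R) (nu mu : set R -> \bar R) :=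
  forall A : set R, measurable A ->
    pi (A `*` setT) = nu A /\ pi (setT `*` A) = mu A.

Definition msupp (pi : probability (R * R)%type R) : set (R * R) :=
  [set z : R * R | forall e : R, 0 < e ->
     (0%E < pi ([set x : R | (z.1 - e < x < z.1 + e)%R] `*`
                [set y : R | (z.2 - e < y < z.2 + e)%R]))%E].

Definition Winf (nu mu : set R -> \bar R) : \bar R :=
  ereal_inf [set c | exists pi : probability (R * R)%type R,
     is_coupling pi nu mu /\
     c = ereal_sup [set (`|z.1 - z.2|)%:E | z in msupp pi]].

End winf.

(* Delta^u_infty := max over (s_i,s_j) in Q, theta in Theta (with positive
   secret masses, where conditional laws are defined) of W_infty *)
Definition Delta_inf (R : realType) (d : nat) (dS dX : measure_display)
  (S : measurableType dS) (X : measurableType dX)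
  (Q : set (S * S)) (Theta : set (probability (S * X)%type R))
  (f : X -> 'rV[R]_d) (u : Rd R d) : \bar R :=
  ereal_sup [set c | exists theta si sj,
     Theta theta /\ Q (si, sj) /\ (0 < smass theta si)%E /\ (0 < smass theta sj)%E /\
     c = Winf (cond_proj_law theta f si u) (cond_proj_law theta f sj u)].

Section renyi.
Context (R : realType).

Definition is_density (P Q : set R -> \bar R) (g : R -> R) : Prop :=
  measurable_fun setT g /\ (forall x, 0 <= g x) /\
  forall A : set R, measurable A -> P A = (\int[Q]_(x in A) (g x)%:E)%E.

Definition renyi_of (alpha : R) (Q : set R -> \bar R) (g : R -> R) : \bar R :=
  match (\int[Q]_x (powR (g x) alpha)%:E)%E with
  | r%:E => (ln r / (alpha - 1))%:E
  | +oo%E => +oo%E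
  | -oo%E => -oo%E
  end.

Definition renyi (alpha : R) (P Q : set R -> \bar R) : \bar R :=
  match pselect (exists g, is_density P Q g) with
  | left H => renyi_of alpha Q (projT1 (cid H))
  | right _ => +oo%E
  end.

End renyi.

(* AveSD^omega_alpha(P||Q) = \int D_alpha(Psi^u_# P || Psi^u_# Q) d omega(u),
   where P, Q are given through their projected laws u |-> Psi^u_# P *)
Definition AveSD (R : realType) (d : nat) (alpha : R) (omega : probability (Rd R d) R)
  (Pu Qu : Rd R d -> set R -> \bar R) : \bar R :=
  (\int[omega]_(u in @sphere R d) renyi alpha (Pu u) (Qu u))%E.

(* (alpha, eps, omega)-Ave-SRPP in (S, Q, Theta) for a mechanism whose
   projected conditional laws are (theta, s, u) |-> Psi^u_# M^theta_s *)
Definition AveSRPP (R : realType) (d : nat) (dS dX : measure_display)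
  (S : measurableType dS) (X : measurableType dX)
  (alpha eps : R) (omega : probability (Rd R d) R)
  (Q : set (S * S)) (Theta : set (probability (S * X)%type R))
  (Mlaw : probability (S * X)%type R -> S -> Rd R d -> set R -> \bar R) : Prop :=
  forall theta si sj, Theta theta -> Q (si, sj) ->
    (0 < smass theta si)%E -> (0 < smass theta sj)%E ->
    (AveSD alpha omega (Mlaw theta si) (Mlaw theta sj) <= eps%:E)%E.

(* N ~ N(0, sigma^2 I_d) on (OmN, PN): measurable coordinates, and every
   linear functional <N, v> is N(0, sigma^2 |v|^2) (delta_0 if degenerate) *)
Definition is_gaussian (R : realType) (d : nat) (dN : measure_display)
  (OmN : measurableType dN) (PN : probability OmN R) (N : OmN -> 'rV[R]_d)
  (sigma : R) : Prop :=
  (forall i : 'I_d, measurable_fun setT (fun w => N w ord0 i)) /\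
  forall (v : 'rV[R]_d) (B : set R), measurable B ->
    pushforward PN (fun w => dotv (N w) v) B =
    (if sigma * normv v == 0 then \d_(0 : R) B
     else normal_prob 0 (sigma * normv v) B).

Definition iid_law (R : realType) (d : nat) (dO : measure_display)
  (Om : measurableType dO) (P : probability Om R) (m : nat)
  (U : 'I_m -> Om -> Rd R d) (omega : probability (Rd R d) R) : Prop :=
  forall A : 'I_m -> set (Rd R d), (forall l, measurable (A l)) ->
    P (\bigcap_(l in [set: 'I_m]) (U l @^-1` A l)) =
    (\prod_(l < m) fine (omega (A l)))%:E.

(* Main.v *)
(* For a fixed direction u, a coupling of the projected conditional laws with
   |x - y| <= r almost surely exhibits the two projected mechanism laws as
   Gaussian mixtures over the same mixing measure; the tangent inequality of
   t^alpha, integrated against the coupling, bounds their Renyi divergence of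
   order alpha by alpha r^2 / (2 sigma^2).  Hence 2 sigma^2 / alpha times the
   divergence is at most (Delta^u)^2, for every noise level and every admissible
   prior and pair of secrets.

   The map u |-> Delta^u is not assumed measurable.  It is replaced by a
   measurable minorant g <= (Delta^u)^2, the pointwise supremum of a countable
   family of normalised divergences (measurable in u by Tonelli's theorem) whose
   integrals approach the supremum of the integrals of all of them.  Hoeffding's
   inequality for g(U_1), ..., g(U_m) then bounds the integral of g by the
   empirical mean of the squared estimates plus the deviation term, except on an
   event of probability gamma / 4.

   If sigma = 0, the variance condition forces Delta_0 = 0, and all conditional
   projected laws of an admissible pair coincide. *)
Require Import Defs.
From HB Require Import structures.
From mathcomp Require Import all_boot all_order all_algebra.
From mathcomp Require Import all_classical all_reals all_analysis.
From mathcomp Require Import measurable_realfun ring lra.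
Import Order.TTheory GRing.Theory Num.Theory.
Import numFieldNormedType.Exports.

Set Implicit Arguments.
Unset Strict Implicit.
Unset Printing Implicit Defensive.

Local Open Scope classical_set_scope.
Local Open Scope ring_scope.

(** * Weighted integrals *)

Section weighted_integral.
Local Open Scope ereal_scope.
Import HBNNSimple.

(** Monotone convergence along simple approximations of [phi], then linearity. The right side sees
    [X1] and [W1] only through weighted masses of preimages, so two such integrals can be
    compared. *)
Lemma ge0_weighted_integral_approx {d1 d} {R : realType}
    {T1 : measurableType d1} {T : measurableType d}
    (m1 : {measure set T1 -> \bar R}) (X1 : T1 -> T) (W1 : T1 -> R)
    (phi : T -> \bar R) (mphi : measurable_fun [set: T] phi) :
  measurable_fun [set: T1] X1 -> measurable_fun [set: T1] W1 ->
  (forall x, 0 <= W1 x)%R -> (forall t, 0 <= phi t) ->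
  let f_ := nnsfun_approx measurableT mphi in
  \int[m1]_x (phi (X1 x) * (W1 x)%:E) =
  limn (fun n => \sum_(k \in range (f_ n))
     k%:E * \int[m1]_x ((\1_(f_ n @^-1` [set k]) (X1 x))%:E * (W1 x)%:E)).
Proof.
move=> mX mW W0 phi0 f_.
have mW' : measurable_fun [set: T1] (fun x => (W1 x)%:E) by exact/measurable_EFinP.
have mind n k : measurable_fun [set: T1]
    (fun x => (\1_(f_ n @^-1` [set k]) (X1 x) : R)).
  by apply: measurableT_comp => //; exact: measurable_indic.
transitivity (limn (fun n => \int[m1]_x ((f_ n (X1 x))%:E * (W1 x)%:E))).
  rewrite -monotone_convergence//.
  - apply: eq_integral => x _; apply/esym/cvg_lim => //.
    apply: cvgeZr => //; exact: cvg_nnsfun_approx.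
  - move=> n; apply: emeasurable_funM => //; apply/measurable_EFinP.
    exact: measurableT_comp.
  - by move=> n x _; rewrite mule_ge0// lee_fin.
  - move=> x _ a b ab; rewrite lee_wpmul2r ?lee_fin//.
    exact/lefP/nd_nnsfun_approx.
congr (limn _); apply/funext => n.
under eq_integral.
  move=> x _; rewrite fimfunE -fsumEFin// ge0_mule_fsuml; last first.
    by move=> k; exact: nnfun_muleindic_ge0.
  over.
rewrite ge0_integral_fsum//; last 2 first.
- move=> k; apply: emeasurable_funM => //; apply/measurable_EFinP.
  apply: measurable_funM; [exact: measurable_cst|exact: mind].
- by move=> k x _; rewrite mule_ge0 ?lee_fin// -lee_fin EFinM nnfun_muleindic_ge0.
apply: eq_fsbigr => k; rewrite inE => -[t _ <-].
under eq_integral do rewrite EFinM -muleA.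
rewrite ge0_integralZl//.
- by apply: emeasurable_funM => //; apply/measurable_EFinP; exact: mind.
- by move=> x _; rewrite mule_ge0 ?lee_fin.
- by rewrite lee_fin.
Qed.

(** Common form of the changes of measure used below: passing to an image law, to a density, to a
    conditional law, and splitting off one independent factor. Both limits run along the same simple
    functions. *)
Lemma ge0_weighted_integral_transfer {d1 d2 d} {R : realType}
    {T1 : measurableType d1} {T2 : measurableType d2} {T : measurableType d}
    (m1 : {measure set T1 -> \bar R}) (m2 : {measure set T2 -> \bar R})
    (X1 : T1 -> T) (X2 : T2 -> T) (W1 : T1 -> R) (W2 : T2 -> R)
    (phi : T -> \bar R) :
  measurable_fun [set: T1] X1 -> measurable_fun [set: T2] X2 ->
  measurable_fun [set: T1] W1 -> measurable_fun [set: T2] W2 ->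
  (forall x, 0 <= W1 x)%R -> (forall x, 0 <= W2 x)%R ->
  (forall A, measurable A ->
    \int[m1]_x ((\1_A (X1 x))%:E * (W1 x)%:E) =
    \int[m2]_x ((\1_A (X2 x))%:E * (W2 x)%:E)) ->
  measurable_fun [set: T] phi -> (forall t, 0 <= phi t) ->
  \int[m1]_x (phi (X1 x) * (W1 x)%:E) = \int[m2]_x (phi (X2 x) * (W2 x)%:E).
Proof.
move=> mX1 mX2 mW1 mW2 W10 W20 eqA mphi phi0.
rewrite (ge0_weighted_integral_approx _ mphi)//.
rewrite (ge0_weighted_integral_approx _ mphi)//.
congr (limn _); apply/funext => n; apply: eq_fsbigr => k _.
by rewrite eqA.
Qed.

End weighted_integral.

(** * Hoeffding's inequality *)

Lemma ge0_is_derive_ge {R : realType} (f df : R -> R) (x : R) :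
  (forall y : R, is_derive y 1 f (df y)) -> (forall y, 0 < y -> 0 <= df y) ->
  0 <= x -> f 0 <= f x.
Proof.
move=> fd df0; rewrite le_eqVlt => /predU1P[<-//|x0].
have fc : {within `[0, x], continuous f}.
  apply: derivable_within_continuous => y _; exact: ex_derive.
have [y] := MVT x0 (fun y _ => fd y) fc; rewrite in_itv/= => /andP[y0 _] fE.
by rewrite -subr_ge0 fE subr0 mulr_ge0 ?df0 ?ltW.
Qed.

Section two_point.
Context {R : realType} (p : R).
Hypothesis p01 : 0 <= p <= 1.
Let s (x : R) : R := 1 - p + p * expR x.

Let s_gt0 x : 0 < s x.
Proof.
rewrite /s; have := expR_gt0 x; case/andP: p01 => p0 p1 e0.
have [->|pn0] := eqVneq p 0; first by rewrite subr0 mul0r addr0.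
by rewrite ltr_wpDl ?subr_ge0// mulr_gt0// lt0r pn0.
Qed.

Let is_derive_s (x : R) : is_derive x 1 s (p * expR x).
Proof.
rewrite /s; apply: is_derive_eq.
rewrite /GRing.scale/=; ring.
Qed.

(** Hoeffding's lemma for a Bernoulli variable of mean [p], whose moment generating function is [s].
    The logarithmic gap [D] and its derivative vanish at 0, and its second derivative is
    nonnegative. *)
Lemma two_point_mgf_le x : 0 <= x -> s x <= expR (x * p + x ^+ 2 / 8).
Proof.
move=> x0.
pose D (y : R) : R := y * p + y ^+ 2 / 8 - ln (s y).
pose D' (y : R) : R := p + y / 4 - 1 + (1 - p) / s y.
pose D'' (y : R) : R := 4^-1 - (1 - p) * (p * expR y) / s y ^+ 2.
have dD (y : R) : is_derive y 1 D (D' y).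
  have dl : is_derive y 1 (@ln R \o s) ((s y)^-1 * (p * expR y)).
    exact: (@is_derive1_comp R (@ln R) s y _ _ (is_derive1_ln (s_gt0 y)) (is_derive_s y)).
  rewrite (_ : D = (fun y => y * p + y ^+ 2 / 8) - (@ln R \o s))//.
  apply: is_derive_eq; rewrite /D'/GRing.scale/=.
  have := s_gt0 y; rewrite /s => sy; field; exact: lt0r_neq0.
have dD' (y : R) : is_derive y 1 D' (D'' y).
  rewrite /D'; have sy0 : s y != 0 by rewrite gt_eqF.
  have dV := @is_deriveV R s y (p * expR y) 1 sy0 (is_derive_s y).
  apply: is_derive_eq; rewrite /D''/GRing.scale/=.
  by field.
have D''0 y : 0 <= D'' y.
  rewrite /D'' subr_ge0 ler_pdivrMr ?exprn_gt0 ?s_gt0//.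
  (* With [a = 1 - p] and [b = p * expR y], so that [s y = a + b], this is
     [4 * a * b <= (a + b) ^+ 2]. *)
  have := sqr_ge0 (1 - p - p * expR y); rewrite /s; nra.
have D'0 y : 0 <= y -> 0 <= D' y.
  move=> y0; have := ge0_is_derive_ge dD' (fun z _ => D''0 z) y0.
  suff -> : D' 0 = 0 by [].
  rewrite /D' /s expR0 mulr1 subrK divr1 mul0r; ring.
have := ge0_is_derive_ge dD (fun z z0 => D'0 _ (ltW z0)) x0.
rewrite /D /s expR0 mulr1 subrK ln1 expr0n/= !mul0r addr0 subr0 subr_ge0 => h.
by rewrite -[leLHS]lnK ?posrE ?s_gt0// ler_expR.
Qed.

End two_point.

(** Convexity of [expR] on the segment between 0 and [lam]. *)
Lemma expR_chord_le {R : realType} (lam y : R) : 0 <= y <= 1 ->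
  expR (lam * y) <= 1 + (expR lam - 1) * y.
Proof.
move=> /andP[y0 y1].
have := @convex_expR R (Itv01 y0 y1) lam 0.
rewrite !convRE/= /unstable.onem mulr0 addr0 expR0 mulr1 [y * lam]mulrC.
move/le_trans; apply; lra.
Qed.

Section iid.
Context {R : realType} {d : nat} {dO : measure_display} {Om : measurableType dO}.
Variables (P : probability Om R) (m : nat) (U : 'I_m -> Om -> Rd R d).
Variable omega : probability (Rd R d) R.
Hypothesis mU : forall l, measurable_fun [set: Om] (U l).
Hypothesis iidU : iid_law P U omega.

Lemma iid_integral_prod (phi : 'I_m -> Rd R d -> R) (c : 'I_m -> R) :
  (forall l, measurable_fun [set: Rd R d] (phi l)) ->
  (forall l u, 0 <= phi l u) ->
  (forall l, \int[omega]_u (phi l u)%:E = (c l)%:E)%E ->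
  (\int[P]_w (\prod_(l < m) phi l (U l w))%:E = (\prod_(l < m) c l)%:E)%E.
Proof.
move=> mphi phi0 phic.
(* replace the indicators of the product rule by the phi l one index at a time *)
pose F k (A : 'I_m -> set (Rd R d)) (l : 'I_m) u : R :=
  if (l < k)%N then phi l u else \1_(A l) u.
pose C k (A : 'I_m -> set (Rd R d)) (l : 'I_m) : R :=
  if (l < k)%N then c l else fine (omega (A l)).
have F0 k A l u : 0 <= F k A l u by rewrite /F; case: ifP.
have mF k A l : measurable (A l) -> measurable_fun setT (fun w => F k A l (U l w)).
  move=> mA; apply: (measurableT_comp (f := F k A l)) => //.
  by rewrite /F; case: (l < k)%N => //; exact: measurable_indic.
suff H k A : (forall l, measurable (A l)) ->
    (\int[P]_w (\prod_(l < m) F k A l (U l w))%:E = (\prod_(l < m) C k A l)%:E)%E.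
  have := H m (fun=> setT) (fun=> measurableT).
  rewrite /C; under eq_bigr do rewrite ltn_ord; move=> <-.
  by apply: eq_integral => w _; congr EFin; apply: eq_bigr => l _; rewrite /F ltn_ord.
elim: k A => [|k IH] A mA.
  rewrite /F/= /C/= -(iidU mA).
  rewrite -[in RHS](setIT (\bigcap_(l in _) _)) -integral_indic//; last first.
    apply: fin_bigcap_measurable => // l _; rewrite -[X in measurable X]setTI; exact: mU.
  apply: eq_integral => w _; congr EFin; rewrite indicE.
  case: (pselect (forall l, A l (U l w))) => h.
    rewrite mem_set; last by move=> l _; exact: h.
    by rewrite big1// => l _; rewrite indicE mem_set.
  rewrite memNset; last by move=> h'; apply: h => l; exact: h'.
  have /existsNP[l nl] := h.
  by rewrite (bigD1 l)//= indicE memNset// mul0r.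
(* No index equals [k] once [m <= k], so stages [k] and [k.+1] coincide. *)
have [mk|km] := leqP m k.
  have FE l u : F k.+1 A l u = F k A l u.
    by rewrite /F ltnS (leq_trans (ltnW (ltn_ord l)) mk) (leq_trans (ltn_ord l) mk).
  have CE l : C k.+1 A l = C k A l.
    by rewrite /C ltnS (leq_trans (ltnW (ltn_ord l)) mk) (leq_trans (ltn_ord l) mk).
  under eq_bigr do rewrite CE.
  rewrite -IH//; apply: eq_integral => w _; congr EFin.
  by apply: eq_bigr => l _; rewrite FE.
pose k0 := Ordinal km.
pose upd B l := if l == k0 then B else A l.
have mupd B : measurable B -> forall l, measurable (upd B l).
  by move=> mB l; rewrite /upd; case: ifP.
pose W w := \prod_(l < m | l != k0) F k A l (U l w).
pose K := \prod_(l < m | l != k0) C k A l.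
have lk l : l != k0 -> (l < k.+1)%N = (l < k)%N.
  by move=> lk0; rewrite ltnS leq_eqVlt -(inj_eq val_inj)/= in lk0 *; rewrite (negbTE lk0).
transitivity (\int[P]_w ((phi k0 (U k0 w))%:E * (W w)%:E))%E.
  apply: eq_integral => w _; rewrite -EFinM; congr EFin.
  rewrite (bigD1 k0)//= {1}/F ltnSn; congr (_ * _).
  by apply: eq_bigr => l lk0; rewrite /F lk.
have W0 w : 0 <= W w by apply: prodr_ge0 => l _; exact: F0.
have c0 l : 0 <= c l.
  by rewrite -lee_fin -phic; apply: integral_ge0 => u _; rewrite lee_fin.
have K0 : 0 <= K.
  by apply: prodr_ge0 => l _; rewrite /C; case: ifP => // _; exact: fine_ge0.
(* The other factors form a weight [W], under which [U k0] has law [K] times [omega]. This is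
   checked on sets [B] by the induction hypothesis with [A k0] replaced by [B]. *)
rewrite (@ge0_weighted_integral_transfer _ _ _ _ _ _ _ P omega (U k0) id W
  (fun=> K) (fun u => (phi k0 u)%:E))//.
- rewrite ge0_integralZr//=.
  + rewrite phic -EFinM (bigD1 k0)//= {1}/C ltnSn; congr (_ * _)%:E.
    by apply: eq_bigr => l lk0; rewrite /C lk.
  + exact/measurable_EFinP.
  + by move=> u _; rewrite lee_fin.
- rewrite /W; under eq_fun do rewrite -big_filter.
  by apply: measurable_prod => l; rewrite mem_filter => _; exact: mF.
- move=> B mB.
  transitivity (\int[P]_w (\prod_(l < m) F k (upd B) l (U l w))%:E)%E.
    apply: eq_integral => w _; rewrite -EFinM; congr EFin.
    rewrite [RHS](bigD1 k0)//= {1}/F ltnn {1}/upd eqxx; congr (_ * _).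
    by apply: eq_bigr => l lk0; rewrite /F /upd (negbTE lk0).
  rewrite IH; last exact: mupd.
  rewrite ge0_integralZr//=.
  + rewrite integral_indic// setIT.
    rewrite (bigD1 k0)//= {1}/C ltnn {1}/upd eqxx EFinM fineK//; last exact: fin_num_measure.
    congr (_ * _%:E)%E; apply: eq_bigr => l lk0.
    by rewrite /C /upd (negbTE lk0).
  + by apply/measurable_EFinP; exact: measurable_indic.
- exact/measurable_EFinP.
- by move=> u; rewrite lee_fin.
Qed.

(** Chernoff's method: Markov's inequality for the exponential of the sum, whose mean factorises by
    independence. *)
Lemma hoeffding_iid (Y : Rd R d -> R) (y t : R) :
  measurable_fun [set: Rd R d] Y -> (forall u, 0 <= Y u <= 1) ->
  (\int[omega]_u (Y u)%:E = y%:E)%E -> 0 <= t ->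
  (P [set w | m%:R * (y + t) < \sum_(l < m) Y (U l w)]%R
     <= (expR (- (2 * m%:R * t ^+ 2)))%:E)%E.
Proof.
move=> mY Y01 Yy t0.
have Y0 u : 0 <= Y u by case/andP: (Y01 u).
have y0 : 0 <= y.
  by rewrite -lee_fin -Yy; apply: integral_ge0 => u _; rewrite lee_fin.
have y1 : y <= 1.
  rewrite -lee_fin -Yy -(@probability_setT _ _ _ omega) -[leRHS]mul1e.
  rewrite -[X in (_ <= X * _)%E]/(1%:E)%E -integral_cst//.
  apply: ge0_le_integral => //.
  - by move=> u _; rewrite lee_fin.
  - exact/measurable_EFinP.
  - by move=> u _; rewrite lee_fin; case/andP: (Y01 u).
(* the optimal exponent *)
pose lam := 4 * t; have lam0 : 0 <= lam by rewrite mulr_ge0.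
pose phi u := expR (lam * Y u).
have mphi : measurable_fun setT phi.
  by apply: measurableT_comp => //; exact: measurable_funM.
(* The chord bound compares [Y] with a Bernoulli variable of the same mean [y], to which the
   two-point estimate applies. *)
have ephi : (\int[omega]_u (phi u)%:E <= (expR (lam * y + lam ^+ 2 / 8))%:E)%E.
  apply: (@le_trans _ _ (1 + (expR lam - 1) * y)%:E); last first.
    rewrite lee_fin (le_trans _ (two_point_mgf_le _ lam0)) ?y0//; lra.
  rewrite EFinD EFinM -Yy -ge0_integralZl//; last 3 first.
  - exact/measurable_EFinP.
  - by move=> u _; rewrite lee_fin.
  - by rewrite lee_fin subr_ge0 -expR0 ler_expR.
  rewrite -(@probability_setT _ _ _ omega) -[X in (_ <= X + _)%E]mul1e.
  rewrite -[X in (_ <= X * _ + _)%E]/(1%:E)%E -integral_cst//.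
  rewrite -ge0_integralD//; last 2 first.
  - move=> u _; rewrite -EFinM lee_fin mulr_ge0//.
    by rewrite subr_ge0 -expR0 ler_expR.
  - by apply/measurable_EFinP; exact: measurable_funM.
  apply: ge0_le_integral => //.
  - by move=> u _; rewrite lee_fin expR_ge0.
  - exact/measurable_EFinP.
  - by apply/measurable_EFinP; apply: measurable_funD => //; exact: measurable_funM.
  - by move=> u _; rewrite -EFinM -EFinD lee_fin expR_chord_le.
have phifin : (\int[omega]_u (phi u)%:E)%E \is a fin_num.
  rewrite ge0_fin_numE; first exact: le_lt_trans ephi (ltry _).
  by apply: integral_ge0 => u _; rewrite lee_fin expR_ge0.
pose c := fine (\int[omega]_u (phi u)%:E)%E.
have c0 : 0 <= c by apply: fine_ge0; apply: integral_ge0 => u _; rewrite lee_fin expR_ge0.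
have cle : c <= expR (lam * y + lam ^+ 2 / 8) by rewrite -lee_fin fineK.
have := @iid_integral_prod (fun=> phi) (fun=> c) (fun=> mphi)
  (fun _ u => expR_ge0 _) (fun=> esym (fineK phifin)).
rewrite big_const_ord iter_mulr_1 => EE.
set B := [set w | _].
have mS : measurable_fun setT (fun w => \sum_(l < m) Y (U l w)).
  by apply: measurable_sum => l; exact: measurableT_comp.
have mB : measurable B.
  rewrite (_ : B = setT `&` (fun w => \sum_(l < m) Y (U l w)) @^-1` `]m%:R * (y + t), +oo[).
    exact: mS.
  by apply/seteqP; split => w /=; rewrite in_itv/= andbT // => -[].
have Ppos : 0 < expR (lam * (m%:R * (y + t))) by exact: expR_gt0.
rewrite -(@lee_pmul2l _ (expR (lam * (m%:R * (y + t))))%:E)//.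
rewrite -integral_cst// -EFinM -expRD.
apply: (@le_trans _ _ (\int[P]_w (\prod_(l < m) phi (U l w))%:E)%E).
  have mprod : measurable_fun setT (fun w => (\prod_(l < m) phi (U l w))%:E).
    by apply/measurable_EFinP; apply: measurable_prod => l _; exact: measurableT_comp.
  have prod0 w : (0 <= (\prod_(l < m) phi (U l w))%:E)%E.
    by rewrite lee_fin; apply: prodr_ge0 => l _; exact: expR_ge0.
  apply: (@le_trans _ _ (\int[P]_(w in B) (\prod_(l < m) phi (U l w))%:E)%E); last first.
    exact: ge0_subset_integral.
  apply: ge0_le_integral => //.
  - by move=> w _; rewrite lee_fin expR_ge0.
  - exact: measurable_funTS.
  - move=> w Bw; rewrite lee_fin -expR_sum -mulr_sumr ler_expR ler_wpM2l//.
    exact: ltW.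
rewrite EE lee_fin (le_trans (lerXn2r _ _ _ cle)) ?nnegrE ?expR_ge0//.
rewrite -expRM_natl ler_expR /lam.
(* With [lam = 4 * t] both exponents equal [m * (4 * t * y + 2 * t ^+ 2)]. *)
by rewrite le_eqVlt; apply/orP; left; apply/eqP; field.
Qed.

(** The upper tail bound is applied to [Y = 1 - g / M], which takes values in [0, 1] and turns a
    deficit of the empirical mean of [g] into an excess. *)
Lemma hoeffding_iid_lower (g : Rd R d -> R) (M e t : R) :
  (0 < m)%N -> measurable_fun [set: Rd R d] g -> (forall u, 0 <= g u <= M) ->
  (\int[omega]_u (g u)%:E = e%:E)%E -> 0 <= t ->
  (P [set w | (\sum_(l < m) g (U l w)) / m%:R + M * t < e]%R
     <= (expR (- (2 * m%:R * t ^+ 2)))%:E)%E.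
Proof.
move=> m0 mg gM ge t0.
have g0 u : 0 <= g u by case/andP: (gM u).
have M0 : 0 <= M by case/andP: (gM 0) => a b; exact: le_trans a b.
have mR0 : 0 < m%:R :> R by rewrite ltr0n.
(* Rescaling divides by [M]; for [M = 0] both [g] and [e] vanish and the event is empty. *)
have [M00|MN0] := eqVneq M 0.
  rewrite (_ : [set w | _] = set0) ?measure0 ?lee_fin ?expR_ge0//.
  apply/seteqP; split => // w /=; rewrite M00 mul0r addr0.
  have -> : e = 0.
    apply: EFin_inj; rewrite -ge integral0_eq// => u _.
    by have := gM u; rewrite M00 => /andP[? ?]; congr EFin; apply/eqP; rewrite eq_le; apply/andP.
  by rewrite ltNge divr_ge0// sumr_ge0.
have Mpos : 0 < M by rewrite lt0r MN0.
pose Y u := 1 - g u / M.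
have mgM : measurable_fun setT (fun u => g u / M) by exact: measurable_funM.
have mY : measurable_fun setT Y by exact: measurable_funB.
have Y01 u : 0 <= Y u <= 1.
  rewrite /Y subr_ge0 ler_pdivrMr// mul1r; case/andP: (gM u) => gu0 ->/=.
  by rewrite gerBl divr_ge0.
have Yge u : (0 <= (Y u)%:E)%E by rewrite lee_fin; case/andP: (Y01 u).
have gMe : (\int[omega]_u (g u / M)%:E = (e / M)%:E)%E.
  rewrite EFinM -ge -ge0_integralZr//.
  - exact/measurable_EFinP.
  - by move=> u _; rewrite lee_fin.
  - by rewrite lee_fin invr_ge0.
have Ye : (\int[omega]_u (Y u)%:E = (1 - e / M)%:E)%E.
  have : (\int[omega]_u (Y u)%:E + \int[omega]_u (g u / M)%:E = 1)%E.
    rewrite -ge0_integralD//; last 3 first.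
    - exact/measurable_EFinP.
    - by move=> u _; rewrite lee_fin divr_ge0.
    - exact/measurable_EFinP.
    rewrite -(@probability_setT _ _ _ omega) -[RHS]mul1e.
    rewrite -[X in _ = (X * _)%E]/(1%:E)%E -integral_cst//.
    by apply: eq_integral => u _; rewrite -EFinD /Y subrK.
  rewrite gMe => /eqP; rewrite eq_sym -sube_eq// => [/eqP <-//|].
  by rewrite fin_num_adde_defl.
apply: le_trans (hoeffding_iid mY Y01 Ye t0).
rewrite le_eqVlt; apply/orP; left; apply/eqP; congr (P _).
apply/seteqP; split => w /=; rewrite /Y sumrB sumr_const card_ord -mulr_suml.
- set s := \sum_(_ < _) _ => h.
  have : (s / m%:R + M * t) / M * m%:R < e / M * m%:R by rewrite ltr_pM2r// ltr_pM2r// invr_gt0.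
  rewrite mulrDl mulrDl [M * t]mulrC mulfK// (_ : s / m%:R / M * m%:R = s / M); first lra.
  by field; rewrite MN0 gt_eqF.
- set s := \sum_(_ < _) _ => h.
  have : (s / m%:R + M * t) / M * m%:R < e / M * m%:R; last by rewrite ltr_pM2r// ltr_pM2r// invr_gt0.
  rewrite mulrDl mulrDl [M * t]mulrC mulfK// (_ : s / m%:R / M * m%:R = s / M); first lra.
  by field; rewrite MN0 gt_eqF.
Qed.

End iid.

(** * Measurable suprema for uncountable families *)

(** The family may be uncountable, so its pointwise supremum need not be measurable. A sequence of
    indices whose integrals approach their supremum [V] is enough: the supremum along it is
    measurable and has integral at least [V]. *)
Lemma countable_sup_integral_ge {d} {T : measurableType d} {R : realType}
    (mu : probability T R) (I : Type) (i0 : I) (h : I -> T -> R) (M : R) :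
  (forall i, measurable_fun [set: T] (h i)) -> (forall i x, 0 <= h i x <= M) ->
  exists g : T -> R, [/\ measurable_fun [set: T] g, (forall x, 0 <= g x <= M),
    (forall x r, (forall i, h i x <= r) -> g x <= r) &
    forall i, (\int[mu]_x (h i x)%:E <= \int[mu]_x (g x)%:E)%E].
Proof.
move=> mh hM.
have h0 i x : (0 <= (h i x)%:E)%E by rewrite lee_fin; case/andP: (hM i x).
have hmu i : measurable_fun setT (fun x => (h i x)%:E) by exact/measurable_EFinP.
pose V := ereal_sup [set \int[mu]_x (h i x)%:E | i in [set: I]]%E.
have Vge i : (\int[mu]_x (h i x)%:E <= V)%E by apply: ereal_sup_ubound; exists i.
have Vfin : V \is a fin_num.
  rewrite ge0_fin_numE; last first.
    by rewrite (le_trans _ (Vge i0))// integral_ge0.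
  apply: (@le_lt_trans _ _ M%:E); last exact: ltry.
  apply: ge_ereal_sup => _ [i _ <-].
  rewrite -[leRHS]mule1 -(@probability_setT _ _ _ mu) -integral_cst//.
  apply: ge0_le_integral => //.
  by move=> x _; rewrite lee_fin; case/andP: (hM i x).
have /choice[s sP] (k : nat) : exists i, (V - (k.+1%:R^-1)%:E < \int[mu]_x (h i x)%:E)%E.
  have [||_ [i _ <-] ?] := @ub_ereal_sup_adherent R
    [set \int[mu]_x (h i x)%:E | i in [set: I]]%E k.+1%:R^-1 => //.
  by exists i.
pose G x := esups (fun n => (h (s n) x)%:E) 0%N.
have mG : measurable_fun setT G.
  exact: (@measurable_fun_esups _ _ _ _ (fun n x => (h (s n) x)%:E)).
have Gge n x : ((h (s n) x)%:E <= G x)%E.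
  by apply: ereal_sup_ubound; exists n.
have Gle x r : (forall i, h i x <= r) -> (G x <= r%:E)%E.
  by move=> hr; apply: ge_ereal_sup => _ [n _ <-]; rewrite lee_fin.
have G0 x : (0 <= G x)%E by rewrite (le_trans (h0 (s 0%N) x)).
have GM x : (G x <= M%:E)%E by apply: Gle => i; case/andP: (hM i x).
have Gfin x : G x \is a fin_num.
  by rewrite ge0_fin_numE//; exact: le_lt_trans (GM x) (ltry _).
exists (fine \o G); split.
- exact: measurableT_comp.
- by move=> x /=; rewrite -!lee_fin fineK// G0 GM.
- by move=> x r hr /=; rewrite -lee_fin fineK// Gle.
move=> i; apply: le_trans (Vge i) _.
rewrite (eq_integral G); last by move=> x _ /=; rewrite fineK.
apply/lee_addgt0Pr => e e0.
have [k ke] : exists k : nat, (k.+1%:R^-1 < e :> R).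
  exists (Num.truncn e^-1); rewrite invf_plt ?posrE//.
  exact: truncnS_gt.
rewrite -leeBlDr//; apply: (@le_trans _ _ (V - (k.+1%:R^-1)%:E)%E).
  by rewrite leeB// lee_fin ltW.
apply: le_trans (ltW (sP k)) _.
by apply: ge0_le_integral.
Qed.

(** * Couplings and the infinity-Wasserstein distance *)

Section coupling.
Context {R : realType}.
Implicit Type pi : probability (R * R)%type R.

(* The complement of the support is covered by countably many null boxes with
   rational endpoints. *)
Lemma msupp_setC_negligible pi : pi.-negligible (~` msupp pi).
Proof.
pose box (q : (rat * rat) * (rat * rat)) : set (R * R) :=
  `]ratr q.1.1, ratr q.1.2[ `*` `]ratr q.2.1, ratr q.2.2[.
pose F n := if unpickle n is Some q then
    if pi (box q) == 0%E then box q else set0 else set0.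
have Fneg n : pi.-negligible (F n).
  rewrite /F; case: unpickle => [q|]; last exact: negligible_set0.
  case: ifPn => [/eqP q0|_]; last exact: negligible_set0.
  by apply/negligibleP => //; apply: measurableX.
apply: negligibleS (negligible_bigcup Fneg) => z /=.
move=> /existsNP[e /not_implyP[e0]] /negP; rewrite -leNgt => zle.
have near_rat (x : R) : exists q : rat * rat,
    [/\ x - e < ratr q.1, ratr q.1 < x, x < ratr q.2 & ratr q.2 < x + e].
  have [a] := @rat_in_itvoo R (x - e) x ltac:(by rewrite gtrBl).
  have [b] := @rat_in_itvoo R x (x + e) ltac:(by rewrite ltrDl).
  by rewrite !in_itv/= => /andP[? ?] /andP[? ?]; exists (a, b).
have [q1 [a1 a2 a3 a4]] := near_rat z.1.
have [q2 [b1 b2 b3 b4]] := near_rat z.2.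
have [n Fn] : exists n, F n = if pi (box (q1, q2)) == 0%E then box (q1, q2) else set0.
  by exists (pickle (q1, q2)); rewrite /F pickleK.
exists n; first exact: I; rewrite Fn.
have boxz : box (q1, q2) z by split; rewrite /= in_itv/= ?a2 ?a3 ?b2 ?b3.
suff -> : pi (box (q1, q2)) == 0%E by [].
rewrite eq_le measure_ge0 andbT (le_trans _ zle)//.
have mitv (x : R) : measurable [set y | x - e < y < x + e].
  have -> : [set y | x - e < y < x + e] = `]x - e, x + e[%classic.
    by apply/seteqP; split => y /=; rewrite in_itv.
  exact: measurable_itv.
apply: le_measure; rewrite ?inE.
- by apply: measurableX.
- by apply: measurableX.
move=> w [/= ]; rewrite !in_itv/= => /andP[c1 c2] /andP[c3 c4].
by split; apply/andP; split; lra.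
Qed.

Lemma msupp_sup_ae pi (r : R) :
  (ereal_sup [set (`|z.1 - z.2|)%:E | z in msupp pi] <= r%:E)%E ->
  {ae pi, forall z, `|z.1 - z.2| <= r}.
Proof.
move=> supr; apply: negligibleS (msupp_setC_negligible pi) => z /= nz zs.
apply: nz; rewrite -lee_fin; apply: le_trans supr.
by apply: ereal_sup_ubound; exists z.
Qed.

(** The strict inequality yields a coupling from the definition of the infimum, without appeal to
    attainment. *)
Lemma Winf_coupling (nu mu : set R -> \bar R) (r : R) :
  (Winf nu mu < r%:E)%E -> exists pi, is_coupling pi nu mu /\
    {ae pi, forall z, `|z.1 - z.2| <= r}.
Proof.
move=> /ereal_inf_lt[_ [pi [cpi ->]] supr]; exists pi; split => //.
by apply: msupp_sup_ae; exact: ltW.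
Qed.

End coupling.

(** * Gaussian mixtures and Renyi divergence *)

Section gaussian.
Context {R : realType}.
Implicit Types (x z c : R) (sigma : R).
Local Notation leb := (@lebesgue_measure R).

Lemma measurable_normal_pdf2 {d} {T : measurableType d} sigma (X Z : T -> R) :
  sigma != 0 -> measurable_fun [set: T] X -> measurable_fun [set: T] Z ->
  measurable_fun [set: T] (fun t => normal_pdf (X t) sigma (Z t)).
Proof.
move=> s0 mX mZ; under eq_fun do rewrite normal_pdfE//.
apply: measurable_funM => //; apply: measurableT_comp => //.
apply: measurable_funM => //; apply: measurableT_comp => //.
by apply: measurable_funX => //; exact: measurable_funB.
Qed.

Lemma normal_pdf_gt0 sigma x z : sigma != 0 -> 0 < normal_pdf x sigma z.
Proof.
by move=> s0; rewrite normal_pdfE// mulr_gt0 ?normal_peak_gt0 ?expR_gt0.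
Qed.

Let shift c (x : measurableTypeR R) : measurableTypeR R := c + x.

Let measurable_shift c : measurable_fun setT (shift c).
Proof. exact: measurable_funD. Qed.

Lemma lebesgue_measure_shift c (A : set R) : measurable A ->
  pushforward leb (shift c) A = leb A.
Proof.
have mc := measurable_shift c.
move=> mA; apply/esym/lebesgue_measure_unique => //= _ [[a b]] _ <-.
rewrite /pushforward.
have -> : shift c @^-1` `]a, b] = `]a - c, b - c]%classic.
  by apply/seteqP; split => x; rewrite /= !in_itv/= ltrBlDl lerBrDl.
rewrite !lebesgue_measure_itv/= !lte_fin ltrD2r.
by case: ifP => // _; rewrite -!EFinD; congr EFin; lra.
Qed.

Lemma normal_prob_shift c sigma (B : set R) : sigma != 0 -> measurable B ->
  normal_prob 0 sigma [set y | B (c + y)] = normal_prob c sigma B.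
Proof.
move=> s0 mB; rewrite /normal_prob.
have mc := measurable_shift c.
transitivity (\int[pushforward leb (shift c)]_(y in B) (normal_pdf c sigma y)%:E)%E.
  rewrite ge0_integral_pushforward//.
  - apply: eq_integral => y _ /=; congr EFin.
    by rewrite !normal_pdfE// /normal_fun subr0 /shift [c + y]addrC addrK.
  - by apply: measurable_funTS; apply/measurable_EFinP; exact: measurable_normal_pdf.
  - by move=> y _; rewrite lee_fin normal_pdf_ge0.
by apply: eq_measure_integral => A mA _; exact: lebesgue_measure_shift.
Qed.

End gaussian.

Section gaussian_mixture.
Context {R : realType} {d : measure_display} {T : measurableType d}.
Variables (P : probability T R) (X : T -> R) (sigma : R).
Hypotheses (s0 : sigma != 0) (mX : measurable_fun [set: T] X).

(** For [sigma != 0], the density of the law of [X] convolved with a centred normal law of variance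
    [sigma ^+ 2]. Then [fine] loses nothing, since normal densities are bounded by their peak. *)
Definition gauss_mix (z : R) : R := fine (\int[P]_t (normal_pdf (X t) sigma z)%:E)%E.

Let mpdf z : measurable_fun setT (fun t => (normal_pdf (X t) sigma z)%:E).
Proof. by apply/measurable_EFinP; exact: measurable_normal_pdf2. Qed.

Lemma gauss_mixE z : ((gauss_mix z)%:E = \int[P]_t (normal_pdf (X t) sigma z)%:E)%E.
Proof.
rewrite fineK// ge0_fin_numE; last first.
  by apply: integral_ge0 => t _; rewrite lee_fin normal_pdf_ge0.
apply: (@le_lt_trans _ _ (normal_peak sigma)%:E); last exact: ltry.
rewrite -[leRHS]mule1 -(@probability_setT _ _ _ P) -integral_cst//.
apply: ge0_le_integral => //.
- by move=> t _; rewrite lee_fin normal_pdf_ge0.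
- by move=> t _; rewrite lee_fin normal_pdf_ub.
Qed.

(** A zero integral would make the integrand, positive everywhere, vanish almost everywhere under a
    law of mass 1. *)
Lemma gauss_mix_gt0 z : 0 < gauss_mix z.
Proof.
rewrite lt_neqAle; apply/andP; split; last first.
  rewrite -lee_fin gauss_mixE.
  by apply: integral_ge0 => t _; rewrite lee_fin normal_pdf_ge0.
apply/eqP => mix0; have := gauss_mixE z; rewrite -mix0 => /esym.
have -> : (\int[P]_t (normal_pdf (X t) sigma z)%:E =
    \int[P]_t `|(normal_pdf (X t) sigma z)%:E|)%E.
  by apply: eq_integral => t _; rewrite gee0_abs// lee_fin normal_pdf_ge0.
move/(ae_eq_integral_abs P measurableT (mpdf z)) => [N [mN N0 subN]].
have : (P setT <= P N)%E.
  apply: le_measure; rewrite ?inE// => t _; apply: subN => /= /(_ I) [].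
  by move/eqP; rewrite gt_eqF// normal_pdf_gt0.
by rewrite probability_setT N0 lee_fin ler10.
Qed.

Lemma measurable_gauss_mix : measurable_fun [set: R] gauss_mix.
Proof.
apply/measurable_EFinP.
have -> : EFin \o gauss_mix = fun z => (\int[P]_t (normal_pdf (X t) sigma z)%:E)%E.
  by apply/funext => z; exact: gauss_mixE.
apply: (@measurable_fun_fubini_tonelli_F _ _ R T R P
  (fun w => (normal_pdf (X w.2) sigma w.1)%:E)).
- apply/measurable_EFinP; apply: measurable_normal_pdf2 => //.
  exact: measurableT_comp.
- by move=> w; rewrite lee_fin normal_pdf_ge0.
Qed.

End gaussian_mixture.

Lemma gt0_measurable_funV {d} {T : measurableType d} {R : realType} (q : T -> R) :
  (forall t, 0 < q t) -> measurable_fun [set: T] q ->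
  measurable_fun [set: T] (fun t => (q t)^-1).
Proof.
move=> q0 mq; under eq_fun do rewrite -powR_inv1 ?ltW//.
exact: (measurableT_comp (measurable_powR _)).
Qed.

(** * Power integrals of the likelihood ratio of coupled Gaussian mixtures *)

Section renyi_gaussian.
Context {R : realType}.
Variables (alpha sigma : R).
Hypotheses (a1 : 1 < alpha) (s0 : sigma != 0).
Local Notation leb := (@lebesgue_measure R).

Let alpha0 : 0 < alpha. Proof. exact: lt_trans a1. Qed.

(* Tangent line of the convex map t |-> t^alpha at t0, in perspective form. *)
Lemma powR_tangent_perspective (a b t0 : R) : 0 < a -> 0 < b -> 0 < t0 ->
  alpha * t0 `^ (alpha - 1) * a <=
  b * (a / b) `^ alpha + (alpha - 1) * t0 `^ alpha * b.
Proof.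
move=> a0 b0 t00.
(* In this variable the claim is the tangent inequality for the power function at 1, stated as
   [xle]. *)
pose x := a / (b * t0).
have x0 : 0 < x by rewrite divr_gt0// mulr_gt0.
have aE : a = x * b * t0 by rewrite /x; field; rewrite !gt_eqF.
have -> : a / b = x * t0 by rewrite /x; field; rewrite !gt_eqF.
rewrite powRM ?(ltW x0) ?(ltW t00)// aE.
have tE : t0 `^ alpha = t0 * t0 `^ (alpha - 1) by rewrite mulr_powRB1// ltW.
have xle : alpha * x <= x `^ alpha + alpha - 1.
  (* Bernoulli's inequality: the chord bound between 0 and [ln x * alpha], evaluated at the fraction
     [alpha^-1], where the exponential is [x]. *)
  have i01 : 0 <= alpha^-1 <= 1.
    by rewrite invr_ge0 ltW//= invf_le1// ltW.
  have := expR_chord_le (ln x * alpha) i01.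
  rewrite mulfK ?gt_eqF// expRM !lnK ?posrE//.
  rewrite -(ler_pM2l alpha0) => /le_trans; apply.
  by rewrite le_eqVlt; apply/orP; left; apply/eqP; field; rewrite gt_eqF.
rewrite tE; set T := t0 `^ (alpha - 1).
have T0 : 0 <= T by exact: powR_ge0.
rewrite -subr_ge0 (_ : _ - _ = T * t0 * b * (x `^ alpha + alpha - 1 - alpha * x)); last by ring.
by rewrite mulr_ge0 ?subr_ge0// !mulr_ge0// ltW.
Qed.

(** Completing the square: with [m = alpha * x + (1 - alpha) * y], [alpha * (z - x) ^+ 2 + (1 -
    alpha) * (z - y) ^+ 2 = (z - m) ^+ 2 - alpha * (alpha - 1) * (x - y) ^+ 2]. *)
Lemma normal_pdf_perspective (x y z : R) :
  normal_pdf y sigma z * (normal_pdf x sigma z / normal_pdf y sigma z) `^ alpha =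
  expR (alpha * (alpha - 1) * (x - y) ^+ 2 / (2 * sigma ^+ 2)) *
  normal_pdf (alpha * x + (1 - alpha) * y) sigma z.
Proof.
rewrite !normal_pdfE//; set c := normal_peak sigma.
have c0 : c != 0 by rewrite gt_eqF ?normal_peak_gt0.
rewrite -mulf_div divff// mul1r /normal_fun -expRN -expRD -expRM.
rewrite -[LHS]mulrA -expRD [RHS]mulrCA -expRD; congr (_ * expR _).
by rewrite -mulr_natl; field.
Qed.

(** Joint convexity of the perspective of the power function gives [pq_le] for each [z]. Tonelli's
    theorem then integrates [z] out first, where the normal density has mass 1, and the coupling
    bounds the remaining factor [E]. *)
Lemma gauss_mix_renyi_le (pi : probability (R * R)%type R) (r : R) :
  {ae pi, forall z, `|z.1 - z.2| <= r} ->
  (\int[leb]_z ((gauss_mix pi fst sigma z / gauss_mix pi snd sigma z) `^ alpha *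
      gauss_mix pi snd sigma z)%:E <=
     (expR (alpha * (alpha - 1) * r ^+ 2 / (2 * sigma ^+ 2)))%:E)%E.
Proof.
move=> pir; set p := gauss_mix pi fst sigma; set q := gauss_mix pi snd sigma.
have p0 z : 0 < p z by exact: gauss_mix_gt0.
have q0 z : 0 < q z by exact: gauss_mix_gt0.
have mp : measurable_fun setT p by exact: measurable_gauss_mix.
have mq : measurable_fun setT q by exact: measurable_gauss_mix.
pose E (w : R * R) := expR (alpha * (alpha - 1) * (w.1 - w.2) ^+ 2 / (2 * sigma ^+ 2)).
pose J (w : R * R) z := E w * normal_pdf (alpha * w.1 + (1 - alpha) * w.2) sigma z.
have mE : measurable_fun setT E.
  apply: measurableT_comp => //; apply: measurable_funM => //.
  apply: measurable_funM => //; apply: measurable_funX.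
  exact: measurable_funB.
have mlin : measurable_fun setT (fun w : R * R => alpha * w.1 + (1 - alpha) * w.2).
  by apply: measurable_funD; apply: measurable_funM.
have J0 w z : 0 <= J w z by rewrite mulr_ge0 ?expR_ge0 ?normal_pdf_ge0.
have mJ : measurable_fun setT (fun v : R * (R * R) => (J v.2 v.1)%:E).
  apply/measurable_EFinP; apply: measurable_funM; first exact: measurableT_comp.
  apply: measurable_normal_pdf2 => //.
  exact: (measurableT_comp mlin measurable_snd).
have mJz z : measurable_fun setT (fun w => (J w z)%:E).
  apply/measurable_EFinP; apply: measurable_funM => //.
  exact: measurable_normal_pdf2.
have mfst z : measurable_fun setT (fun w : R * R => (normal_pdf w.1 sigma z)%:E).
  by apply/measurable_EFinP; exact: measurable_normal_pdf2.
have msnd z : measurable_fun setT (fun w : R * R => (normal_pdf w.2 sigma z)%:E).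
  by apply/measurable_EFinP; exact: measurable_normal_pdf2.
have pdf0 x z : (0 <= (normal_pdf x sigma z)%:E)%E by rewrite lee_fin normal_pdf_ge0.
have pq_le z : (((p z / q z) `^ alpha * q z)%:E <= \int[pi]_w (J w z)%:E)%E.
  (* At this tangent point the terms linear in [p z] and [q z] combine to exactly the left side of
     the claim. *)
  pose t := p z / q z; have t0 : 0 < t by exact: divr_gt0.
  have := @ge0_le_integral _ _ _ pi setT measurableT
    (fun w => (alpha * t `^ (alpha - 1))%:E * (normal_pdf w.1 sigma z)%:E)%E
    (fun w => (J w z)%:E + ((alpha - 1) * t `^ alpha)%:E * (normal_pdf w.2 sigma z)%:E)%E.
  have c10 : (0 <= (alpha * t `^ (alpha - 1))%:E)%E.
    by rewrite lee_fin mulr_ge0 ?powR_ge0// ltW.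
  have c20 : (0 <= ((alpha - 1) * t `^ alpha)%:E)%E.
    by rewrite lee_fin mulr_ge0 ?powR_ge0// subr_ge0 ltW.
  rewrite ge0_integralZl// ge0_integralD//; last 3 first.
  - by move=> w _; rewrite lee_fin.
  - by move=> w _; rewrite mule_ge0.
  - exact: measurable_funeM.
  rewrite ge0_integralZl// -!gauss_mixE// -/(p z) -/(q z) => H.
  have {H} : ((alpha * t `^ (alpha - 1))%:E * (p z)%:E <= \int[pi]_w (J w z)%:E +
      ((alpha - 1) * t `^ alpha)%:E * (q z)%:E)%E.
    apply: H.
    - by move=> w _; rewrite mule_ge0.
    - exact: measurable_funeM.
    - by apply: emeasurable_funD => //; exact: measurable_funeM.
    - move=> w _; rewrite -!EFinM -EFinD lee_fin /J /E -normal_pdf_perspective.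
      by apply: powR_tangent_perspective => //; exact: normal_pdf_gt0.
  rewrite -!EFinM -leeBlDr// -EFinB; apply: le_trans; rewrite lee_fin.
  have tE : t `^ alpha = t * t `^ (alpha - 1) by rewrite mulr_powRB1// ltW.
  have pE : p z = t * q z by rewrite /t divfK// gt_eqF.
  rewrite -/t pE tE le_eqVlt; apply/orP; left; apply/eqP; ring.
have pqge0 z : (0 <= ((p z / q z) `^ alpha * q z)%:E)%E.
  by rewrite lee_fin mulr_ge0 ?powR_ge0// ltW.
apply: (@le_trans _ _ (\int[leb]_z \int[pi]_w (J w z)%:E)%E).
  apply: ge0_le_integral => //.
  - apply/measurable_EFinP; apply: measurable_funM => //.
    apply: (measurableT_comp (measurable_powR _)) => //.
    by apply: measurable_funM => //; exact: gt0_measurable_funV.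
  - apply: (@measurable_fun_fubini_tonelli_F _ _ R (R * R)%type R pi
      (fun v => (J v.2 v.1)%:E)) => // v.
    by rewrite lee_fin.
rewrite (@fubini_tonelli _ _ _ _ _ leb pi (fun v => (J v.2 v.1)%:E))//; last first.
  by move=> v; rewrite lee_fin.
apply: (@le_trans _ _ (\int[pi]_w (E w)%:E)%E).
  rewrite le_eqVlt; apply/orP; left; apply/eqP; apply: eq_integral => w _ /=.
  under eq_integral do rewrite /J EFinM.
  rewrite ge0_integralZl//=.
  - by rewrite integral_normal_pdf mule1.
  - by apply/measurable_EFinP; exact: measurable_normal_pdf.
  - by rewrite lee_fin expR_ge0.
set C := expR _.
rewrite -[leRHS]mule1 -(@probability_setT _ _ _ pi) -integral_cst//.
apply: ae_ge0_le_integral => //.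
- by move=> w _; rewrite lee_fin expR_ge0.
- exact/measurable_EFinP.
- by move=> w _; rewrite lee_fin expR_ge0.
apply: filterS pir => w wr _; rewrite lee_fin ler_expR.
have s20 : 0 < 2 * sigma ^+ 2 by rewrite pmulr_rgt0 ?exprn_even_gt0.
rewrite ler_pM2r ?invr_gt0//.
rewrite ler_wpM2l ?mulr_ge0 ?subr_ge0 ?(ltW a1) ?(ltW alpha0)//.
have r0 : 0 <= r by rewrite (le_trans _ wr).
by rewrite -(real_normK (num_real (w.1 - w.2))) lerXn2r ?nnegrE.
Qed.

End renyi_gaussian.

(** * Divergence and conditioning for laws given as set functions *)

(** [renyi] picks its density by choice. Finiteness of [P] makes [g] integrable, hence almost
    everywhere equal to the density picked, so the integral of the power is the same. *)
Lemma renyi_densityE {R : realType} (alpha : R) (P : set R -> \bar R)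
    (m : {measure set R -> \bar R}) (g : R -> R) :
  (P setT < +oo)%E -> is_density P m g -> renyi alpha P m = renyi_of alpha m g.
Proof.
move=> Pfin dg; rewrite /renyi; case: pselect => [H|[]]; last by exists g.
case: cid => g' /= [mg' [g'0 Pg']]; have [mg [g0 Pg]] := dg.
rewrite /renyi_of.
have gi : m.-integrable setT (EFin \o g).
  apply/integrableP; split; first exact/measurable_EFinP.
  rewrite (eq_integral (fun x => (g x)%:E)) -?Pg//.
  by move=> x _ /=; rewrite ger0_norm.
have aeg : ae_eq m setT (EFin \o g) (EFin \o g').
  apply: integral_ae_eq => //; first exact/measurable_EFinP.
  by move=> E _ mE; rewrite -Pg// -Pg'.
suff -> : (\int[m]_x (g' x `^ alpha)%:E = \int[m]_x (g x `^ alpha)%:E)%E by [].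
have mpow (k : R -> R) : measurable_fun setT k ->
    measurable_fun setT (fun x => (k x `^ alpha)%:E).
  by move=> mk; apply/measurable_EFinP; exact: (measurableT_comp (measurable_powR _)).
apply: ge0_ae_eq_integral => //.
- exact: mpow.
- exact: mpow.
- by move=> x _; rewrite lee_fin powR_ge0.
- by move=> x _; rewrite lee_fin powR_ge0.
by apply: filterS aeg => x /= h /h [->].
Qed.

(** The projected laws are bare set functions, defined on nonmeasurable sets too. This turns them
    into measures, so that integration lemmas apply to them. *)
Lemma measure_of_eq_measurable {d} {T : measurableType d} {R : realType}
    (nu : set T -> \bar R) (mu : {measure set T -> \bar R}) :
  (forall A, 0 <= nu A)%E -> (forall A, measurable A -> nu A = mu A) ->
  exists m : {measure set T -> \bar R}, nu = m.
Proof.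
move=> nu0 numu.
have nu00 : nu set0 = 0%E by rewrite numu.
have nus : semi_sigma_additive nu.
  move=> F mF tF mUF; rewrite numu//.
  rewrite (_ : (fun n => _) = (fun n => \sum_(0 <= i < n) mu (F i))%E).
    exact: measure_semi_sigma_additive.
  by apply/funext => n; apply: eq_bigr => i _; exact: numu.
pose mx := isMeasure.Build _ _ _ nu nu00 nu0 nus.
pose m : {measure set T -> \bar R} := HB.pack nu mx.
by exists m.
Qed.

Section conditional_probability.
Context {d} {T : measurableType d} {R : realType}.
Implicit Types (mu nu : probability T R) (D : set T).

(** The law given [D], with the same quotient of [fine] masses as in the projected laws. *)
Definition is_cond_prob nu mu D := forall A, measurable A ->
  nu A = (fine (mu (A `&` D)) / fine (mu D))%:E.

Lemma cond_prob_exists mu D : measurable D -> (0 < mu D)%E ->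
  exists nu, is_cond_prob nu mu D.
Proof.
(* The last argument of [mnormalize] is its default for zero or infinite mass; both cases are
   excluded below. *)
move=> mD D0; exists (mnormalize (mrestr mu mD) mu) => A mA.
rewrite /= /mnormalize /= /mrestr setTI gt_eqF//=.
have fD : mu D \is a fin_num by exact: fin_num_measure.
have fA : mu (A `&` D) \is a fin_num by apply: fin_num_measure; exact: measurableI.
case: eqP => [Dy|_]; first by move: fD; rewrite Dy.
by rewrite EFinM fineK.
Qed.

(** The conditional law has density [\1_D / mu D] with respect to [mu]. *)
Lemma cond_prob_integral nu mu D (G : T -> \bar R) :
  measurable D -> is_cond_prob nu mu D ->
  measurable_fun [set: T] G -> (forall t, 0 <= G t)%E ->
  (\int[nu]_t G t = \int[mu]_t (G t * (\1_D t / fine (mu D))%:E))%E.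
Proof.
move=> mD nuE mG G0.
have D0 : 0 <= fine (mu D) by exact: fine_ge0.
have mDf : measurable_fun setT (fun t => \1_D t / fine (mu D) : R).
  by apply: measurable_funM => //; exact: measurable_indic.
transitivity (\int[nu]_t (G t * 1%:E))%E.
  by apply: eq_integral => t _; rewrite mule1.
apply: (@ge0_weighted_integral_transfer _ _ _ _ _ _ _ nu mu id id
  (fun=> 1) (fun t => \1_D t / fine (mu D)) G) => //.
  by move=> t; rewrite divr_ge0.
move=> A mA.
under eq_integral do rewrite mule1.
rewrite integral_indic// setIT.
transitivity (fine (mu (A `&` D)) / fine (mu D))%:E; first exact: nuE.
under eq_integral do rewrite EFinM muleA.
rewrite ge0_integralZr//=.
- rewrite (eq_integral (EFin \o \1_(A `&` D))); last first.
    by move=> t _; rewrite /= indicI -EFinM.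
  rewrite integral_indic ?setIT//; last exact: measurableI.
  by rewrite EFinM fineK//; apply: fin_num_measure; exact: measurableI.
- by apply: emeasurable_funM; apply/measurable_EFinP; exact: measurable_indic.
- by rewrite lee_fin invr_ge0.
Qed.

End conditional_probability.

(** * Projected laws of the mechanism *)

Lemma dotvDl {R : realType} {d : nat} (a b u : 'rV[R]_d) :
  dotv (a + b) u = dotv a u + dotv b u.
Proof. by rewrite /dotv -big_split/=; apply: eq_bigr => i _; rewrite mxE mulrDl. Qed.

Lemma measurable_dotv {R : realType} {d : nat} {dT} {T : measurableType dT}
    (a b : T -> 'rV[R]_d) :
  (forall i, measurable_fun [set: T] (fun t => a t ord0 i)) ->
  (forall i, measurable_fun [set: T] (fun t => b t ord0 i)) ->
  measurable_fun [set: T] (fun t => dotv (a t) (b t)).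
Proof.
move=> ma mb; apply: measurable_sum => i.
by apply: measurable_funM.
Qed.

Lemma measurable_coord {R : realType} {d : nat} (i : 'I_d) :
  measurable_fun [set: Rd R d] (fun u : Rd R d => (u : 'rV[R]_d) ord0 i).
Proof.
move=> _ A mA; rewrite setTI; apply: sub_sigma_algebra.
by exists i, A.
Qed.

Lemma measurable_sphere {R : realType} {d : nat} : measurable (@sphere R d).
Proof.
have mn : measurable_fun setT (fun u : Rd R d => normv (u : 'rV[R]_d)).
  have msq : measurable_fun setT (@Num.sqrt R).
    by apply: continuous_measurable_fun; exact: sqrt_continuous.
  apply: (measurableT_comp msq).
  by apply: (@measurable_dotv R d _ (Rd R d) id id) => i; exact: measurable_coord.
have := mn measurableT [set 1] (measurable_set1 _).
by rewrite setTI.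
Qed.

Section mechanism.
Context {R : realType} {d : nat} {dS dX dN : measure_display}.
Context {S : measurableType dS} {X : measurableType dX} {OmN : measurableType dN}.
Variables (f : X -> 'rV[R]_d) (PN : probability OmN R) (N : OmN -> 'rV[R]_d).
Variables (theta nu : probability (S * X)%type R) (s : S) (u : Rd R d).
Hypothesis mf : forall i, measurable_fun [set: X] (fun x => f x ord0 i).
Hypothesis mN : forall i, measurable_fun [set: OmN] (fun w => N w ord0 i).
Hypothesis ms : measurable [set s].
Hypothesis nuE : is_cond_prob nu theta ([set s] `*` setT).

Let c (t : S * X) : R := dotv (f t.2) u.
Let n (w : OmN) : R := dotv (N w) u.

Let mD : measurable ([set s] `*` [set: X]). Proof. exact: measurableX. Qed.

Lemma measurable_query_proj : measurable_fun [set: S * X] (fun t => dotv (f t.2) u).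
Proof.
apply: measurable_dotv => i; last exact: measurable_cst.
exact: (measurableT_comp (mf i) measurable_snd).
Qed.

Let mc : measurable_fun setT c. Proof. exact: measurable_query_proj. Qed.

Let mn : measurable_fun setT n.
Proof. by apply: measurable_dotv => i //; exact: measurable_cst. Qed.

Let g (z : (S * X) * OmN) : R := c z.1 + n z.2.

Let mg : measurable_fun setT g.
Proof.
by apply: measurable_funD;
  [exact: (measurableT_comp mc measurable_fst)|exact: (measurableT_comp mn measurable_snd)].
Qed.

Let mgB (B : set R) : measurable B -> measurable (g @^-1` B).
Proof. by move=> mB; rewrite -[X in measurable X]setTI; exact: mg. Qed.

Let secE (B : set R) t : xsection (g @^-1` B) t = [set w | B (c t + n w)].
Proof. by apply/seteqP; split => w /=; rewrite /xsection /= inE. Qed.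

Lemma cond_proj_lawE (B : set R) : measurable B ->
  cond_proj_law theta f s u B = nu [set t | B (dotv (f t.2) u)].
Proof.
move=> mB; rewrite nuE; last first.
  by rewrite -[X in measurable X]setTI; exact: mc.
rewrite /cond_proj_law /smass; congr (fine (theta _) / _)%:E.
by apply/seteqP; split => -[a x] /=; tauto.
Qed.

(** The section of the joint event at [(a, x)] is a shifted noise event if [a = s], and empty
    otherwise. Dividing by the mass of [s] turns the integral over [theta] into one over [nu]. *)
Lemma mech_proj_lawE (B : set R) : measurable B ->
  mech_proj_law f PN N theta s u B =
  (\int[nu]_t PN [set w | B (dotv (f t.2) u + dotv (N w) u)%R])%E.
Proof.
move=> mB.
pose G t := PN [set w | B (c t + n w)].
have mG : measurable_fun setT G.
  rewrite (_ : G = PN \o xsection (g @^-1` B)); last first.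
    by apply/funext => t; rewrite /= secE.
  by apply: measurable_fun_xsection; exact: mgB.
have G0 t : (0 <= G t)%E by exact: measure_ge0.
rewrite (cond_prob_integral mD nuE mG G0) /mech_proj_law.
rewrite -/(smass theta s).
under [RHS]eq_integral do rewrite EFinM muleA.
have mprod : measurable_fun setT (fun t => G t * (\1_([set s] `*` setT) t)%:E)%E.
  by apply: emeasurable_funM => //; apply/measurable_EFinP; exact: measurable_indic.
have a0 : 0 <= fine (smass theta s) by exact: fine_ge0.
rewrite ge0_integralZr//; last 2 first.
- by move=> t _; rewrite mule_ge0// lee_fin.
- by rewrite lee_fin invr_ge0.
set A := [set z | _].
have AE : product_measure1 theta PN A =
    (\int[theta]_t (G t * (\1_([set s] `*` setT) t)%:E))%E.
  apply: eq_integral => -[a x] _ /=.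
  rewrite indicE; have [/set_mem[/= as_ _]|asN] := boolP ((a, x) \in [set s] `*` setT).
    rewrite mule1; congr (PN _); apply/seteqP; split => w; rewrite /xsection /= inE /A /=.
    - by rewrite dotvDl => -[].
    - by rewrite dotvDl.
  rewrite mule0 (_ : xsection A (a, x) = set0) ?measure0//.
  apply/seteqP; split => // w; rewrite /xsection /= inE => -[/= as_ _].
  by move: asN; rewrite notin_setE; apply.
rewrite AE EFinM fineK// ge0_fin_numE; last first.
  by apply: integral_ge0 => t _; rewrite mule_ge0// lee_fin.
apply: (@le_lt_trans _ _ (\int[theta]_t (cst 1%:E t))%E); last first.
  by rewrite integral_cst// mul1e; apply: le_lt_trans (probability_le1 _ _) (ltry _).
apply: ge0_le_integral => //.
- by move=> t _; rewrite mule_ge0// lee_fin.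
- move=> t _ /=; rewrite -[leRHS]mule1 lee_pmul// ?lee_fin//.
  rewrite /G -secE; apply: probability_le1; apply: measurable_xsection; exact: mgB.
Qed.

Lemma mech_proj_law_measure :
  exists m : {measure set R -> \bar R}, mech_proj_law f PN N theta s u = m.
Proof.
apply: (@measure_of_eq_measurable _ _ _ _ (pushforward (nu \x PN)%E g)) => //.
  by move=> A; rewrite lee_fin divr_ge0 ?fine_ge0.
move=> B mB; rewrite mech_proj_lawE//.
by apply: eq_integral => t _; rewrite /= secE.
Qed.

End mechanism.

Lemma measurable_gauss_mix_joint {R : realType} {dV dT} {V : measurableType dV}
    {T : measurableType dT} (P : probability T R) (X : V -> T -> R) (sigma : R) :
  sigma != 0 -> measurable_fun [set: V * T] (fun v => X v.1 v.2) ->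
  measurable_fun [set: V * R] (fun v => gauss_mix P (X v.1) sigma v.2).
Proof.
move=> s0 mX; apply: measurableT_comp => //.
apply: (@measurable_fun_fubini_tonelli_F _ _ (V * R)%type T R P
  (fun w => (normal_pdf (X w.1.1 w.2) sigma w.1.2)%:E)).
- apply/measurable_EFinP; apply: measurable_normal_pdf2 => //; last first.
    exact: (measurableT_comp measurable_snd measurable_fst).
  have mpair : measurable_fun setT (fun w : (V * R) * T => (w.1.1, w.2)).
    apply/measurable_fun_pairP; split.
      exact: (measurableT_comp measurable_fst measurable_fst).
    exact: measurable_snd.
  exact: (measurableT_comp mX mpair).
- by move=> w; rewrite lee_fin normal_pdf_ge0.
Qed.

(** Right continuity of the square; couplings will be at hand only for radii above [r]. *)
Lemma le_sqr_right_limit {R : realType} (L C r : R) : 0 <= C -> 0 <= r ->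
  (forall r', r < r' -> L <= C * r' ^+ 2) -> L <= C * r ^+ 2.
Proof.
move=> C0 r0 h; apply/ler_addgt0Pr => e e0.
(* For [0 < x <= 1] the square bound grows by at most [C * x * (2 * r + 1)] from [r] to [r + x]; the
   added 1 keeps [K] positive when [C = 0]. *)
pose K := C * (2 * r + 1) + 1.
have K0 : 0 < K by rewrite ltr_wpDl// mulr_ge0// addr_ge0// mulr_ge0.
pose x := Num.min 1 (e / K).
have x0 : 0 < x by rewrite lt_min ltr01 divr_gt0.
have x1 : x <= 1 by rewrite ge_min lexx.
have xe : x * K <= e by rewrite -ler_pdivlMr// ge_min lexx orbT.
have := h (r + x); rewrite ltrDl => /(_ x0)/le_trans; apply.
have : C * x * (1 - x) >= 0 by rewrite !mulr_ge0 ?subr_ge0// ltW.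
move: xe; rewrite /K; nra.
Qed.

(** * Projected densities and divergences for nonzero noise *)

Section gaussian_mechanism.
Context {R : realType} {d : nat} {dS dX dN : measure_display}.
Context {S : measurableType dS} {X : measurableType dX} {OmN : measurableType dN}.
Variables (f : X -> 'rV[R]_d) (PN : probability OmN R) (N : OmN -> 'rV[R]_d).
Variable theta : probability (S * X)%type R.
Variable (sigma : R).
Hypothesis mf : forall i, measurable_fun [set: X] (fun x => f x ord0 i).
Hypothesis ms : forall s : S, measurable [set s].
Hypothesis gN : is_gaussian PN N sigma.
Hypothesis sigma0 : sigma != 0.
Local Notation leb := (@lebesgue_measure R).

Let mN i : measurable_fun [set: OmN] (fun w => N w ord0 i). Proof. exact: gN.1. Qed.

(** The density of the projected mechanism law for unit [u]; the variance is not rescaled by the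
    norm of [u]. Having the formula for all [u] gives measurability in [u]. *)
Definition mech_density (nu : probability (S * X)%type R) (u : Rd R d) (z : R) : R :=
  gauss_mix nu (fun t => dotv (f t.2) u) sigma z.

Lemma mech_density_gt0 nu u z : 0 < mech_density nu u z.
Proof. by apply: gauss_mix_gt0 => //; exact: measurable_query_proj. Qed.

Lemma measurable_mech_density nu u : measurable_fun [set: R] (mech_density nu u).
Proof. by apply: measurable_gauss_mix => //; exact: measurable_query_proj. Qed.

Lemma measurable_mech_density_joint nu :
  measurable_fun [set: Rd R d * R] (fun v => mech_density nu v.1 v.2).
Proof.
apply: (@measurable_gauss_mix_joint R _ _ (Rd R d) _ nu
  (fun u t => dotv (f t.2) u)) => //.
apply: (@measurable_dotv R d _ (Rd R d * (S * X))%type (fun v => f v.2.2) (fun v => v.1)) => i.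
  exact: (measurableT_comp (mf i) (measurableT_comp measurable_snd measurable_snd)).
exact: (measurableT_comp (@measurable_coord R d i) measurable_fst).
Qed.

(** For unit [u] the projected noise is centred normal of variance [sigma ^+ 2]; translation by the
    projected query and Tonelli's theorem give the mixture. *)
Lemma mech_proj_law_density nu s u (B : set R) : @sphere R d u ->
  is_cond_prob nu theta ([set s] `*` setT) -> measurable B ->
  mech_proj_law f PN N theta s u B =
  (\int[leb]_(z in B) (mech_density nu u z)%:E)%E.
Proof.
move=> su nuE mB; rewrite (mech_proj_lawE PN u mf mN (ms s) nuE mB).
have mX := @measurable_query_proj R d dS dX S X f u mf.
have pdf0 x z : (0 <= (normal_pdf x sigma z)%:E)%E by rewrite lee_fin normal_pdf_ge0.
transitivity (\int[nu]_t \int[leb]_z ((normal_pdf (dotv (f t.2) u) sigma z)%:E * (\1_B z)%:E))%E.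
  apply: eq_integral => t _.
  have mBs : measurable [set y | B (dotv (f t.2) u + y)].
    have : measurable_fun setT (fun y : R => dotv (f t.2) u + y) by exact: measurable_funD.
    by move=> /(_ measurableT _ mB); rewrite setTI.
  have := gN.2 u _ mBs; rewrite /pushforward /sphere/= in su *.
  rewrite su mulr1 (negbTE sigma0) normal_prob_shift// => ->.
  rewrite /normal_prob integral_mkcond; apply: eq_integral => z _.
  by rewrite epatch_indic.
rewrite (@fubini_tonelli _ _ _ _ _ nu leb
  (fun v => ((normal_pdf (dotv (f v.1.2) u) sigma v.2)%:E * (\1_B v.2)%:E)%E))//; last 2 first.
- apply: emeasurable_funM; apply/measurable_EFinP.
    by apply: measurable_normal_pdf2 => //; exact: (measurableT_comp mX measurable_fst).
  exact: (measurableT_comp (measurable_indic mB) measurable_snd).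
- by move=> v; rewrite mule_ge0// lee_fin.
rewrite [RHS]integral_mkcond; apply: eq_integral => z _ /=.
rewrite epatch_indic ge0_integralZr//=.
- by rewrite /mech_density gauss_mixE.
- by apply/measurable_EFinP; exact: measurable_normal_pdf2.
Qed.

Section pair_of_secrets.
Variables (alpha : R) (nui nuj : probability (S * X)%type R) (si sj : S).
Hypothesis a1 : 1 < alpha.
Hypothesis nuiE : is_cond_prob nui theta ([set si] `*` setT).
Hypothesis nujE : is_cond_prob nuj theta ([set sj] `*` setT).

(** On the sphere, and when finite, this is the exponential of [alpha - 1] times the projected Renyi
    divergence. *)
Definition renyi_integral (u : Rd R d) : \bar R :=
  (\int[leb]_z ((mech_density nui u z / mech_density nuj u z) `^ alpha *
     mech_density nuj u z)%:E)%E.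

Lemma measurable_renyi_integral : measurable_fun [set: Rd R d] renyi_integral.
Proof.
apply: (@measurable_fun_fubini_tonelli_F _ _ (Rd R d) (measurableTypeR R) R leb
  (fun v => ((mech_density nui v.1 v.2 / mech_density nuj v.1 v.2) `^ alpha *
     mech_density nuj v.1 v.2)%:E)).
- apply/measurable_EFinP; apply: measurable_funM; last exact: measurable_mech_density_joint.
  apply: (measurableT_comp (measurable_powR _)); apply: measurable_funM.
    exact: measurable_mech_density_joint.
  apply: gt0_measurable_funV; last exact: measurable_mech_density_joint.
  by move=> v; exact: mech_density_gt0.
- by move=> v; rewrite lee_fin mulr_ge0 ?powR_ge0// ltW// mech_density_gt0.
Qed.

(** The quotient of the two mixture densities is a density of one projected law with respect to the
    other. *)
Lemma renyi_mechE u : @sphere R d u -> renyi_integral u \is a fin_num ->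
  renyi alpha (mech_proj_law f PN N theta si u) (mech_proj_law f PN N theta sj u) =
  (ln (fine (renyi_integral u)) / (alpha - 1))%:E.
Proof.
move=> su Jfin.
have mi B := @mech_proj_law_density nui si u B su nuiE.
have mj B := @mech_proj_law_density nuj sj u B su nujE.
have [m mE] := mech_proj_law_measure PN u mf mN (ms sj) nujE.
set p := mech_density nui u in mi *; set q := mech_density nuj u in mj *.
have p0 z : 0 < p z by exact: mech_density_gt0.
have q0 z : 0 < q z by exact: mech_density_gt0.
have mp : measurable_fun setT p by exact: measurable_mech_density.
have mq : measurable_fun setT q by exact: measurable_mech_density.
have mpq : measurable_fun setT (fun z => p z / q z).
  by apply: measurable_funM => //; exact: gt0_measurable_funV.
(* Integrals against [m] become Lebesgue integrals with density [q]. *)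
have int_m (phi : R -> \bar R) : measurable_fun setT phi -> (forall t, 0 <= phi t)%E ->
    (\int[m]_z phi z = \int[leb]_z (phi z * (q z)%:E))%E.
  move=> mphi phi0; transitivity (\int[m]_z (phi z * 1%:E))%E.
    by apply: eq_integral => z _; rewrite mule1.
  apply: (@ge0_weighted_integral_transfer _ _ _ R R (measurableTypeR R) R m leb id id
    (fun=> 1) q phi) => //.
    by move=> z; exact: ltW.
  move=> A mA; under eq_integral do rewrite mule1.
  rewrite integral_indic// setIT -mE mj// [LHS]integral_mkcond.
  by apply: eq_integral => z _; rewrite epatch_indic/= muleC.
have dens : is_density (mech_proj_law f PN N theta si u) m (fun z => p z / q z).
  split => //; split; first by move=> z; rewrite divr_ge0// ltW.
  move=> A mA; rewrite mi// [LHS]integral_mkcond [RHS]integral_mkcond int_m.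
  - apply: eq_integral => z _; rewrite !epatch_indic/= -!EFinM; congr EFin.
    by rewrite mulrAC divfK// gt_eqF.
  - rewrite epatch_indic; apply: emeasurable_funM; apply/measurable_EFinP;
      [exact: mpq|exact: measurable_indic].
  - by move=> z; rewrite epatch_indic mule_ge0 ?lee_fin ?divr_ge0// ltW.
rewrite mE (renyi_densityE _ _ dens); last exact: ltry.
rewrite /renyi_of (_ : (\int[m]_z ((p z / q z) `^ alpha)%:E)%E = renyi_integral u).
  by case: (renyi_integral u) Jfin.
rewrite int_m.
- by apply: eq_integral => z _; rewrite -EFinM.
- by apply/measurable_EFinP; exact: (measurableT_comp (measurable_powR _)).
- by move=> z; rewrite lee_fin powR_ge0.
Qed.

(** A mixture density depends only on the law of its mixing variable, and the two mixing laws are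
    the marginals of [pi]. *)
Lemma mech_density_coupling (pi : probability (R * R)%type R) u :
  is_coupling pi (cond_proj_law theta f si u) (cond_proj_law theta f sj u) ->
  mech_density nui u = gauss_mix pi fst sigma /\
  mech_density nuj u = gauss_mix pi snd sigma.
Proof.
move=> cpi.
have mX := @measurable_query_proj R d dS dX S X f u mf.
have transfer (nu : probability (S * X)%type R) (pr : R * R -> R) :
    measurable_fun setT pr ->
    (forall A, measurable A -> nu [set t | A (dotv (f t.2) u)] = pi (pr @^-1` A)) ->
    mech_density nu u = gauss_mix pi pr sigma.
  move=> mpr nupi; apply/funext => z; rewrite /mech_density /gauss_mix; congr fine.
  transitivity (\int[nu]_t ((normal_pdf (dotv (f t.2) u) sigma z)%:E * 1%:E))%E.
    by apply: eq_integral => t _; rewrite mule1.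
  transitivity (\int[pi]_t ((normal_pdf (pr t) sigma z)%:E * 1%:E))%E; last first.
    by apply: eq_integral => t _; rewrite mule1.
  apply: (@ge0_weighted_integral_transfer _ _ _ R _ _ R nu pi
    (fun t => dotv (f t.2) u) pr (fun=> 1) (fun=> 1)
    (fun x => (normal_pdf x sigma z)%:E)) => //.
  - move=> A mA; under eq_integral do rewrite mule1.
    under [RHS]eq_integral do rewrite mule1.
    have m1 : measurable [set t : S * X | A (dotv (f t.2) u)].
      by rewrite -[X in measurable X]setTI; exact: mX.
    have m2 : measurable (pr @^-1` A).
      by rewrite -[X in measurable X]setTI; exact: mpr.
    transitivity (\int[nu]_t (\1_[set t : S * X | A (dotv (f t.2) u)] t)%:E)%E.
      by apply: eq_integral => t _; rewrite !indicE.
    transitivity (\int[pi]_t (\1_(pr @^-1` A) t)%:E)%E; last first.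
      by apply: eq_integral => t _; rewrite !indicE.
    rewrite integral_indic// integral_indic// !setIT.
    exact: nupi.
  - apply/measurable_EFinP.
    exact: (@measurable_normal_pdf2 _ _ _ sigma id (fun=> z)).
  - by move=> x; rewrite lee_fin normal_pdf_ge0.
split; apply: transfer => //= A mA; have [ci cj] := cpi _ mA.
- rewrite -(cond_proj_lawE u mf nuiE mA) -ci; congr (pi _).
  by apply/seteqP; split => w /=; tauto.
- rewrite -(cond_proj_lawE u mf nujE mA) -cj; congr (pi _).
  by apply/seteqP; split => w /=; tauto.
Qed.

(** Each [r' > r] admits a coupling and hence the bound, which passes to [r] by right continuity. *)
Lemma Winf_renyi_integral_le u (r : R) :
  (Winf (cond_proj_law theta f si u) (cond_proj_law theta f sj u) <= r%:E)%E ->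
  [/\ 0 <= r, renyi_integral u \is a fin_num &
    ln (fine (renyi_integral u)) <= alpha * (alpha - 1) / (2 * sigma ^+ 2) * r ^+ 2].
Proof.
move=> Wr.
have bound r' : r < r' -> 0 <= r' /\
    (renyi_integral u <= (expR (alpha * (alpha - 1) / (2 * sigma ^+ 2) * r' ^+ 2))%:E)%E.
  move=> rr'; have [|pi [cpi pir]] := @Winf_coupling R (cond_proj_law theta f si u)
      (cond_proj_law theta f sj u) r'.
    by rewrite (le_lt_trans Wr)// lte_fin.
  split.
    (* For a negative radius the null exceptional set would be the whole space. *)
    rewrite leNgt; apply/negP => r'0; have [A [mA A0 subA]] := pir.
    have : (pi setT <= pi A)%E.
      apply: le_measure; rewrite ?inE// => z _; apply: subA => /= zr'.
      by move: (le_lt_trans zr' r'0); rewrite ltNge normr_ge0.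
    by rewrite probability_setT A0 lee_fin ler10.
  have [pE qE] := mech_density_coupling cpi.
  rewrite /renyi_integral pE qE (le_trans (gauss_mix_renyi_le a1 sigma0 pir))//.
  by rewrite lee_fin mulrAC.
have r0 : 0 <= r.
  by apply/ler_addgt0Pr => e e0; have [|] := bound (r + e); rewrite ?ltrDl.
have J0 : (0 <= renyi_integral u)%E.
  apply: integral_ge0 => z _.
  by rewrite lee_fin mulr_ge0 ?powR_ge0// ltW// mech_density_gt0.
have Jfin : renyi_integral u \is a fin_num.
  have [|_ b] := bound (r + 1); first by rewrite ltrDl.
  by rewrite ge0_fin_numE//; exact: le_lt_trans b (ltry _).
have s20 : 0 < 2 * sigma ^+ 2 by rewrite pmulr_rgt0 ?exprn_even_gt0.
have C0 : 0 <= alpha * (alpha - 1) / (2 * sigma ^+ 2).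
  rewrite divr_ge0 ?(ltW s20)// mulr_ge0 ?subr_ge0 ?(ltW a1)//.
  by rewrite (le_trans _ (ltW a1)).
split => //; apply: le_sqr_right_limit => // r' rr'.
have [r'0 b] := bound _ rr'.
(* [ln] takes the value 0 at nonpositive reals. *)
have [Jpos|Jneg] := ltP 0 (fine (renyi_integral u)); last first.
  by rewrite ln0// mulr_ge0// sqr_ge0.
rewrite -[leRHS]expRK ler_ln ?posrE ?expR_gt0//.
by rewrite -lee_fin fineK.
Qed.

End pair_of_secrets.

End gaussian_mechanism.

(** * Zero noise and laws at distance zero *)

(** A coupling within [e] bounds the mass of the closed ray at [x] by the other law's mass of the
    open ray at [x - e]. Letting [e] tend to 0 equates the masses of closed rays, a generating
    family stable under intersection. *)
Lemma Winf_le0_eq {R : realType} (m1 m2 : {measure set R -> \bar R}) :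
  (m1 setT < +oo)%E -> (m2 setT < +oo)%E -> (Winf m1 m2 <= 0)%E ->
  forall A, measurable A -> m1 A = m2 A.
Proof.
move=> fin1 fin2 W0.
have coupled e : 0 < e -> exists2 pi : probability (R * R)%type R,
    is_coupling pi m1 m2 & {ae pi, forall z, `|z.1 - z.2| < e}.
  move=> e0; have [|pi [cpi pie]] := @Winf_coupling R m1 m2 (e / 2).
    by rewrite (le_lt_trans W0)// lte_fin divr_gt0.
  exists pi => //; apply: filterS pie => z /le_lt_trans; apply.
  by rewrite ltr_pdivrMr// ltr_pMr// ltr1n.
have mray (x : R) : measurable `[x, +oo[%classic by exact: measurable_itv.
have moray (x : R) : measurable `]x, +oo[%classic by exact: measurable_itv.
have le12 x e : 0 < e -> (m1 `[x, +oo[%classic <= m2 `](x - e)%R, +oo[%classic)%E.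
  move=> e0; have [pi cpi [N [mN N0 subN]]] := coupled _ e0.
  have [<- _] := cpi _ (mray x); have [_ <-] := cpi _ (moray (x - e)).
  have mX1 : measurable (`[x, +oo[%classic `*` [set: R]) by exact: measurableX.
  have mX2 : measurable ([set: R] `*` `](x - e)%R, +oo[%classic) by exact: measurableX.
  apply: (@le_trans _ _ (pi (([set: R] `*` `](x - e)%R, +oo[%classic) `|` N))); last first.
    by apply: le_trans (measureU2 _ mX2 mN) _; rewrite [X in (_ + X)%E]N0 adde0.
  apply: le_measure; rewrite ?inE//; first exact: measurableU.
  move=> z [+ _]; rewrite /= in_itv/= andbT => xz.
  have [ze|ze] := ltP `|z.1 - z.2| e; [left|right].
    split => //=; rewrite in_itv/= andbT; move: ze; rewrite ltr_norml => /andP[_]; lra.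
  by apply: subN => /=; apply/negP; rewrite -leNgt.
have le21 x e : 0 < e -> (m2 `[x, +oo[%classic <= m1 `](x - e)%R, +oo[%classic)%E.
  move=> e0; have [pi cpi [N [mN N0 subN]]] := coupled _ e0.
  have [_ <-] := cpi _ (mray x); have [<- _] := cpi _ (moray (x - e)).
  have mX1 : measurable ([set: R] `*` `[x, +oo[%classic) by exact: measurableX.
  have mX2 : measurable (`](x - e)%R, +oo[%classic `*` [set: R]) by exact: measurableX.
  apply: (@le_trans _ _ (pi ((`](x - e)%R, +oo[%classic `*` [set: R]) `|` N))); last first.
    by apply: le_trans (measureU2 _ mX2 mN) _; rewrite [X in (_ + X)%E]N0 adde0.
  apply: le_measure; rewrite ?inE//; first exact: measurableU.
  move=> z [_]; rewrite /= in_itv/= andbT => xz.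
  have [ze|ze] := ltP `|z.1 - z.2| e; [left|right].
    split => //=; rewrite in_itv/= andbT; move: ze; rewrite ltr_norml => /andP[+ _]; lra.
  by apply: subN => /=; apply/negP; rewrite -leNgt.
(* Continuity from above: the closed ray at [x] is the intersection of the open rays at
   [x - k.+1%:R^-1]. *)
have lim (m : {measure set R -> \bar R}) (c : \bar R) x : (m setT < +oo)%E ->
    (forall e, 0 < e -> (c <= m `](x - e)%R, +oo[%classic)%E) -> (c <= m `[x, +oo[%classic)%E.
  move=> finm cm; rewrite itvcyEbigcap.
  have cv : (m `](x - k.+1%:R^-1)%R, +oo[%classic @[k --> \oo] -->
      m (\bigcap_k `](x - k.+1%:R^-1)%R, +oo[%classic))%E.
    apply: nonincreasing_cvg_mu => //.
    - by apply: le_lt_trans finm; apply: le_measure; rewrite ?inE.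
    - by rewrite -itvcyEbigcap.
    - move=> a b ab; apply/subsetPset => y /=; rewrite !in_itv/= !andbT.
      apply: le_lt_trans; rewrite lerD2l lerN2 lef_pV2 ?posrE// ler_nat.
      by rewrite ltnS.
  rewrite -(cvg_lim _ cv)//; apply: lime_ge; first exact: cvgP cv.
  by apply: nearW => k; exact: cm.
move=> A mA.
apply: (measure_unique (@RGenCInfty.G R) (fun n => `[- n%:R, +oo[%classic)) => //.
- exact: RGenCInfty.measurableE.
- move=> _ _ [x ->] [y ->]; exists (Num.max x y).
  by apply/seteqP; split => z /=; rewrite !in_itv/= !andbT ge_max => /andP.
- by move=> n; exists (- n%:R).
- apply/seteqP; split => // y _; exists (Num.truncn `|y|).+1 => //=.
  rewrite in_itv/= andbT lerNl; apply: ltW.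
  by apply: le_lt_trans (truncnS_gt _); rewrite -normrN ler_norm.
- move=> _ [x ->]; apply/eqP; rewrite eq_le; apply/andP; split.
  + by apply: lim => // e e0; exact: le12.
  + by apply: lim => // e e0; exact: le21.
- by move=> n; apply: le_lt_trans fin1; apply: le_measure; rewrite ?inE.
Qed.

Section noiseless_mechanism.
Context {R : realType} {d : nat} {dS dX dN : measure_display}.
Context {S : measurableType dS} {X : measurableType dX} {OmN : measurableType dN}.
Variables (f : X -> 'rV[R]_d) (PN : probability OmN R) (N : OmN -> 'rV[R]_d).
Variable theta : probability (S * X)%type R.
Hypothesis mf : forall i, measurable_fun [set: X] (fun x => f x ord0 i).
Hypothesis ms : forall s : S, measurable [set s].
Hypothesis gN : is_gaussian PN N 0.

Let mN i : measurable_fun [set: OmN] (fun w => N w ord0 i). Proof. exact: gN.1. Qed.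

Lemma noiseless_mech_proj_law nu s u (B : set R) :
  is_cond_prob nu theta ([set s] `*` setT) -> measurable B ->
  mech_proj_law f PN N theta s u B = cond_proj_law theta f s u B.
Proof.
move=> nuE mB; rewrite (mech_proj_lawE PN u mf mN (ms s) nuE mB).
rewrite (cond_proj_lawE u mf nuE mB).
have mX := @measurable_query_proj R d dS dX S X f u mf.
have mpre : measurable [set t : S * X | B (dotv (f t.2) u)].
  by rewrite -[X in measurable X]setTI; exact: mX.
transitivity (\int[nu]_t (\1_[set t : S * X | B (dotv (f t.2) u)] t)%:E)%E; last first.
  by rewrite integral_indic// setIT.
apply: eq_integral => t _.
have mBs : measurable [set y | B (dotv (f t.2) u + y)].
  have : measurable_fun setT (fun y : R => dotv (f t.2) u + y) by exact: measurable_funD.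
  by move=> /(_ measurableT _ mB); rewrite setTI.
have := gN.2 u _ mBs; rewrite /pushforward mul0r eqxx => ->.
rewrite diracE indicE; congr ((_ : bool)%:R%:E).
by apply/idP/idP => /set_mem/=; rewrite ?addr0 => h; apply/mem_set => /=; rewrite ?addr0.
Qed.

Lemma cond_proj_law_measure nu s u :
  is_cond_prob nu theta ([set s] `*` setT) ->
  exists2 m : {measure set R -> \bar R}, cond_proj_law theta f s u = m & m setT = 1%E.
Proof.
move=> nuE; have mX := @measurable_query_proj R d dS dX S X f u mf.
have [m mE] : exists m : {measure set R -> \bar R}, cond_proj_law theta f s u = m.
  apply: (@measure_of_eq_measurable _ _ _ _
    (pushforward nu (fun t : S * X => dotv (f t.2) u))) => //.
    by move=> A; rewrite lee_fin divr_ge0 ?fine_ge0.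
  by move=> A mA; exact: cond_proj_lawE.
exists m => //; rewrite -mE (cond_proj_lawE u mf nuE measurableT).
by rewrite -[RHS](@probability_setT _ _ _ nu); congr (nu _); apply/seteqP; split.
Qed.

(** The mechanism law is the query law when [sigma = 0], and equal laws have relative density 1. *)
Lemma noiseless_renyi_eq0 (alpha : R) nui nuj si sj u :
  is_cond_prob nui theta ([set si] `*` setT) ->
  is_cond_prob nuj theta ([set sj] `*` setT) ->
  (Winf (cond_proj_law theta f si u) (cond_proj_law theta f sj u) <= 0)%E ->
  renyi alpha (mech_proj_law f PN N theta si u) (mech_proj_law f PN N theta sj u) = 0%E.
Proof.
move=> nuiE nujE W0.
have [mi miE mi1] := cond_proj_law_measure u nuiE.
have [mj mjE mj1] := cond_proj_law_measure u nujE.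
have mij A : measurable A -> mi A = mj A.
  by apply: Winf_le0_eq; rewrite ?mi1 ?mj1 ?ltry// -miE -mjE.
have [m mE] := mech_proj_law_measure PN u mf mN (ms sj) nujE.
have mjm A : measurable A -> m A = mj A.
  by move=> mA; rewrite -mE -mjE; exact: (noiseless_mech_proj_law _ nujE mA).
have dens : is_density (mech_proj_law f PN N theta si u) m (fun=> 1).
  split => //; split => // A mA.
  by rewrite integral_cst// mul1e mjm// -mij// -miE; exact: (noiseless_mech_proj_law _ nuiE mA).
rewrite mE (renyi_densityE _ _ dens); last exact: ltry.
rewrite /renyi_of; under eq_integral do rewrite powR1.
by rewrite integral_cst// mul1e mjm// mj1 ln1 mul0r.
Qed.

End noiseless_mechanism.

(** * Averaging over slices *)

(** [h] is the positive part of the divergence times [2 * sigma ^+ 2 / alpha], set to 0 off the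
    sphere. The factor makes it comparable with squared distances at every noise level; the positive
    part supplies [0 <= h]. *)
Lemma gaussian_slice_bound {R : realType} {d : nat} {dS dX dN : measure_display}
    {S : measurableType dS} {X : measurableType dX} {OmN : measurableType dN}
    (f : X -> 'rV[R]_d) (PN : probability OmN R) (N : OmN -> 'rV[R]_d)
    (theta : probability (S * X)%type R) (omega : probability (Rd R d) R)
    (si sj : S) (sigma alpha Delta0 : R) :
  (forall i, measurable_fun [set: X] (fun x => f x ord0 i)) ->
  (forall s : S, measurable [set s]) ->
  is_gaussian PN N sigma -> 0 < sigma -> 1 < alpha ->
  (0 < smass theta si)%E -> (0 < smass theta sj)%E ->
  (forall u, @sphere R d u ->
    (Winf (cond_proj_law theta f si u) (cond_proj_law theta f sj u) <= Delta0%:E)%E) ->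
  exists h : Rd R d -> R, [/\ measurable_fun [set: Rd R d] h, (forall u, 0 <= h u),
    (forall u, ~ @sphere R d u -> h u = 0),
    (forall u r, @sphere R d u ->
      (Winf (cond_proj_law theta f si u) (cond_proj_law theta f sj u) <= r%:E)%E ->
      h u <= r ^+ 2) &
    (AveSD alpha omega (mech_proj_law f PN N theta si) (mech_proj_law f PN N theta sj)
      <= (alpha / (2 * sigma ^+ 2))%:E * \int[omega]_u (h u)%:E)%E].
Proof.
move=> mf ms gN s0 a1 mi0 mj0 WD.
have sN0 : sigma != 0 by rewrite gt_eqF.
have mDi : measurable ([set si] `*` [set: X]) by exact: measurableX.
have mDj : measurable ([set sj] `*` [set: X]) by exact: measurableX.
have [nui nuiE] := cond_prob_exists mDi mi0.
have [nuj nujE] := cond_prob_exists mDj mj0.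
pose J := @renyi_integral R d dS dX S X f sigma alpha nui nuj.
have mJ : measurable_fun setT J by exact: measurable_renyi_integral.
pose H u := ln (fine (J u)) / (alpha - 1).
have mH : measurable_fun setT H.
  apply: measurable_funM => //; apply: (measurableT_comp (@measurable_ln R)).
  exact: measurableT_comp.
pose K := 2 * sigma ^+ 2 / alpha.
have al0 : 0 < alpha by exact: lt_trans a1.
have am1 : 0 < alpha - 1 by rewrite subr_gt0.
have s20 : 0 < 2 * sigma ^+ 2 by rewrite pmulr_rgt0 ?exprn_even_gt0.
have K0 : 0 < K by exact: divr_gt0.
have JP u r : (Winf (cond_proj_law theta f si u) (cond_proj_law theta f sj u) <= r%:E)%E ->
    J u \is a fin_num /\ K * H u <= r ^+ 2.
  move=> Wr; have [r0 Jfin lnJ] := Winf_renyi_integral_le mf sN0 a1 nuiE nujE Wr.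
  split => //; rewrite /K /H.
  have : 2 * sigma ^+ 2 / alpha / (alpha - 1) * ln (fine (J u)) <=
      2 * sigma ^+ 2 / alpha / (alpha - 1) *
      (alpha * (alpha - 1) / (2 * sigma ^+ 2) * r ^+ 2).
    by rewrite ler_wpM2l// !divr_ge0// ?(ltW s20) ?(ltW al0) ?(ltW am1).
  rewrite [X in _ <= X](_ : _ = r ^+ 2); last by field; rewrite sN0 !gt_eqF.
  by rewrite -mulrA [_^-1 * _]mulrC.
pose h u := \1_(@sphere R d) u * Num.max 0 (K * H u).
have mS := @measurable_sphere R d.
have mh : measurable_fun setT h.
  apply: measurable_funM; first exact: measurable_indic.
  by apply: measurable_maxr => //; exact: measurable_funM.
have h0 u : 0 <= h u by rewrite mulr_ge0// le_max lexx.
have hS u : @sphere R d u -> h u = Num.max 0 (K * H u).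
  by move=> su; rewrite /h indicE mem_set// mul1r.
exists h; split => //.
- by move=> u su; rewrite /h indicE memNset// mul0r.
- move=> u r su Wr; rewrite hS// ge_max sqr_ge0/=.
  by have [] := JP _ _ Wr.
rewrite /AveSD (eq_integral (fun u => (H u)%:E)); last first.
  move=> u /set_mem su; have [Jfin _] := JP _ _ (WD _ su).
  exact: (renyi_mechE mf ms gN sN0 nuiE nujE).
rewrite integralE.
set C := alpha / _.
have C0 : 0 <= C by rewrite divr_ge0// ?(ltW s20) ?(ltW al0).
apply: (@le_trans _ _ (\int[omega]_(u in @sphere R d) ((fun u => (H u)%:E)^\+ u))%E).
  by rewrite -[leRHS]adde0 leeD2l// oppe_le0 integral_ge0.
rewrite (eq_integral (fun u => C%:E * (h u)%:E)%E); last first.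
  move=> u /set_mem su; rewrite hS// funeposE -EFin_max -EFinM; congr EFin.
  rewrite maxr_pMr// mulr0 maxC mulrA (_ : C * K = 1) ?mul1r//.
  by rewrite /C /K; field; rewrite sN0 gt_eqF.
have mhE (D : set (Rd R d)) : measurable_fun D (fun u => (h u)%:E).
  by apply: measurable_funTS; exact/measurable_EFinP.
rewrite ge0_integralZl//; last by move=> u _; rewrite lee_fin.
apply: lee_wpmul2l => //.
by apply: ge0_subset_integral => // u _; rewrite lee_fin.
Qed.

(** * Concentration over the sampled slices and the privacy guarantee *)

Unset Implicit Arguments.
Set Strict Implicit.
Set Printing Implicit Defensive.

Theorem theorem3 (R : realType) (d : nat)
  (dS dX dN dO : measure_display)
  (S : measurableType dS) (X : measurableType dX)
  (Q : set (S * S)) (Theta : set (probability (S * X)%type R))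
  (f : X -> 'rV[R]_d) (omega : probability (Rd R d) R)
  (m : nat)
  (Om : measurableType dO) (P : probability Om R)
  (U : 'I_m -> Om -> Rd R d) (Dhat : 'I_m -> Om -> R)
  (OmN : measurableType dN) (PN : probability OmN R)
  (Nf : R -> OmN -> 'rV[R]_d) (sigma : Om -> R)
  (Delta0 alpha eps gamma : R) :
  (* secrets: events {S = s} are measurable *)
  (forall s : S, measurable [set s]) ->
  (* f is a (measurable) query X -> R^d *)
  (forall i : 'I_d, measurable_fun setT (fun x => f x ord0 i)) ->
  (* omega: continuous (atomless) distribution on the sphere S^{d-1} *)
  omega (@sphere R d) = 1%E ->
  (forall u : Rd R d, omega [set u] = 0%E) ->
  (* U_1..U_m i.i.d. ~ omega *)
  (0 < m)%N ->
  (forall l, measurable_fun setT (U l)) ->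
  iid_law P U omega ->
  (* 0 <= Delta^u_infty <= Delta0 for all u *)
  (forall u : Rd R d, @sphere R d u -> (Delta_inf Q Theta f u <= Delta0%:E)%E) ->
  1 < alpha -> 0 < eps -> 0 < gamma < 1 ->
  (* Pr(Delta^{U_l}_infty <= Dhat(U_l) for all l) >= 1 - gamma/2 *)
  (exists E : set Om, measurable E /\ ((1 - gamma / 2)%:E <= P E)%E /\
     E `<=` [set w | forall l, (Delta_inf Q Theta f (U l w) <= (Dhat l w)%:E)%E]) ->
  (* the Gaussian noise N ~ N(0, s^2 I_d), independent of X *)
  (forall s : R, 0 <= s -> is_gaussian PN (Nf s) s) ->
  (* the (data-dependent) noise scale sigma satisfies the variance condition *)
  (forall w, 0 <= sigma w) ->
  (forall w, alpha / (2 * eps) *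
       ((\sum_(l < m) Dhat l w ^+ 2) / m%:R
        + Delta0 ^+ 2 * Num.sqrt (ln (4 / gamma) / (2 * m%:R)))
     <= sigma w ^+ 2) ->
  (* then with probability >= 1 - gamma, M(X) = f(X) + N is Ave-SRPP *)
  exists E : set Om, measurable E /\ ((1 - gamma)%:E <= P E)%E /\
    forall w, E w ->
      AveSRPP alpha eps omega Q Theta (mech_proj_law f PN (Nf (sigma w))).
Proof.
move=> ms mf omS _ m0 mU iid DeltaU a1 e0 /andP[g0 g1] [E1 [mE1 [PE1 E1sub]]] gN sig0 sigP.
(* Without an admissible pair the guarantee is vacuous; otherwise the pair found makes the family
   below nonempty. *)
have [[th0 [s1 [s2 V0]]]|noV] := pselect (exists theta si sj,
    [/\ Theta theta, Q (si, sj), (0 < smass theta si)%E & (0 < smass theta sj)%E]); last first.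
  exists setT; split => //; split.
    by rewrite probability_setT lee_fin gerBl ltW.
  move=> w _ theta si sj Tt Qij i0 j0; exfalso; apply: noV.
  by exists theta, si, sj.
have WinfDelta theta si sj u r : Theta theta -> Q (si, sj) ->
    (0 < smass theta si)%E -> (0 < smass theta sj)%E ->
    (Delta_inf Q Theta f u <= r%:E)%E ->
    (Winf (cond_proj_law theta f si u) (cond_proj_law theta f sj u) <= r%:E)%E.
  move=> Tt Qij i0 j0; apply: le_trans; apply: ereal_sup_ubound.
  by exists theta, si, sj.
(* The noise level [sigma w] depends on the outcome, so the family ranges over all positive levels:
   one [g], hence one exceptional event, then serves every [w]. *)
pose valid (k : R * probability (S * X)%type R * S * S) :=
  let: (s, theta, si, sj) := k in
  [/\ 0 < s, Theta theta, Q (si, sj), (0 < smass theta si)%E & (0 < smass theta sj)%E].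
have slice (k : {k | valid k}) : exists h : Rd R d -> R,
    let: (s, theta, si, sj) := sval k in
    [/\ measurable_fun [set: Rd R d] h, (forall u, 0 <= h u <= Delta0 ^+ 2),
    (forall u, ~ @sphere R d u -> h u = 0),
    (forall u r, @sphere R d u -> (Delta_inf Q Theta f u <= r%:E)%E -> h u <= r ^+ 2) &
    (AveSD alpha omega (mech_proj_law f PN (Nf s) theta si)
      (mech_proj_law f PN (Nf s) theta sj)
      <= (alpha / (2 * s ^+ 2))%:E * \int[omega]_u (h u)%:E)%E].
  case: k => -[[[s theta] si] sj] [/= s0 Tt Qij i0 j0].
  have WD u : @sphere R d u ->
      (Winf (cond_proj_law theta f si u) (cond_proj_law theta f sj u) <= Delta0%:E)%E.
    by move=> su; apply: WinfDelta => //; exact: DeltaU.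
  have [h [mh h0 hS hW hA]] := gaussian_slice_bound omega mf ms (gN s (ltW s0)) s0 a1 i0 j0 WD.
  exists h; split => //.
  - move=> u; rewrite h0/=; have [su|su] := pselect (@sphere R d u).
      by apply: hW => //; exact: WD.
    by rewrite hS// sqr_ge0.
  - by move=> u r su Dr; apply: hW => //; exact: WinfDelta.
have [h hP] := choice slice.
have k0 : {k | valid k}.
  by exists (1, th0, s1, s2); case: V0.
have mh k : measurable_fun setT (h k) by have := hP k; case: (sval k) => [[[? ?] ?] ?] [].
have hD k u : 0 <= h k u <= Delta0 ^+ 2.
  by have := hP k; case: (sval k) => [[[? ?] ?] ?] [].
have hS k u : ~ @sphere R d u -> h k u = 0.
  by have := hP k; case: (sval k) => [[[? ?] ?] ?] [_ _ + _ _]; exact.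
have hW k u r : @sphere R d u -> (Delta_inf Q Theta f u <= r%:E)%E -> h k u <= r ^+ 2.
  by have := hP k; case: (sval k) => [[[? ?] ?] ?] [_ _ _ + _]; exact.
have [g [mg gD gle gint]] := @countable_sup_integral_ge _ _ _ omega _ k0 h _ mh hD.
have gfin : (\int[omega]_u (g u)%:E)%E \is a fin_num.
  rewrite ge0_fin_numE; last first.
    by apply: integral_ge0 => u _; rewrite lee_fin; case/andP: (gD u).
  apply: (@le_lt_trans _ _ (Delta0 ^+ 2)%:E); last exact: ltry.
  rewrite -[leRHS]mule1 -(@probability_setT _ _ _ omega) -integral_cst//.
  apply: ge0_le_integral => //.
  - by move=> u _; rewrite lee_fin; case/andP: (gD u).
  - exact/measurable_EFinP.
  - by move=> u _; rewrite lee_fin; case/andP: (gD u).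
pose e := fine (\int[omega]_u (g u)%:E)%E.
have mR0 : 0 < m%:R :> R by rewrite ltr0n.
have ln4 : 0 < ln (4 / gamma).
  by rewrite ln_gt0// ltr_pdivlMr// mul1r (lt_trans g1)// ltr1n.
(* Chosen so that Hoeffding's bound [expR (- (2 * m%:R * t ^+ 2))] equals [gamma / 4]. *)
pose t := Num.sqrt (ln (4 / gamma) / (2 * m%:R)).
have t0 : 0 < t by rewrite sqrtr_gt0 divr_gt0// mulr_gt0.
pose bad := [set w | (\sum_(l < m) g (U l w)) / m%:R + Delta0 ^+ 2 * t < e].
have mbad : measurable bad.
  have mS : measurable_fun setT
      (fun w => (\sum_(l < m) g (U l w)) / m%:R + Delta0 ^+ 2 * t).
    apply: measurable_funD => //; apply: measurable_funM => //.
    by apply: measurable_sum => l; exact: measurableT_comp.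
  rewrite (_ : bad = setT `&` (fun w => (\sum_(l < m) g (U l w)) / m%:R + Delta0 ^+ 2 * t)
      @^-1` `]-oo, e[); first exact: mS.
  by apply/seteqP; split => w /=; rewrite in_itv/= // => -[].
have Pbad : (P bad <= (gamma / 4)%:E)%E.
  apply: le_trans (hoeffding_iid_lower mU iid m0 mg gD (esym (fineK gfin)) (ltW t0)) _.
  rewrite lee_fin /t sqr_sqrtr; last by rewrite divr_ge0 ?mulr_ge0 ?(ltW ln4).
  rewrite [X in expR X](_ : _ = - ln (4 / gamma)); last by field; rewrite gt_eqF.
  by rewrite expRN lnK ?posrE ?divr_gt0// invf_div.
(* The two failure probabilities add up to at most [gamma / 2 + gamma / 4], below [gamma]. *)
exists (E1 `&` ~` bad); split; first by apply: measurableI => //; exact: measurableC.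
split.
  have : (P E1 <= P (E1 `&` ~` bad) + P bad)%E.
    apply: le_trans (measureU2 _ _ _) => //; last first.
      by apply: measurableI => //; exact: measurableC.
    apply: le_measure; rewrite ?inE//.
      by apply: measurableU => //; apply: measurableI => //; exact: measurableC.
    by move=> w Ew; have [bw|bw] := pselect (bad w); [right|left].
  move=> PE; have {PE} := le_trans PE1 (le_trans PE (leeD2l _ Pbad)).
  rewrite -leeBlDr// -EFinB; apply: le_trans; rewrite lee_fin; lra.
move=> w [E1w] /negP; rewrite -leNgt => ew.
(* On [E1] every member of the family at [U l w] is at most the squared estimate, hence so is [g];
   off the sphere the members vanish. *)
have sumle : (\sum_(l < m) g (U l w)) / m%:R <= (\sum_(l < m) Dhat l w ^+ 2) / m%:R.
  rewrite ler_pM2r ?invr_gt0//; apply: ler_sum => l _; apply: gle => k.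
  have [su|su] := pselect (@sphere R d (U l w)).
    by apply: hW => //; exact: E1sub.
  by rewrite hS// sqr_ge0.
have := sigP w; rewrite -/t.
set K := _ / _ + _; move=> Ksig.
have eK : e <= K by apply: le_trans ew _; rewrite lerD2r.
have al0 : 0 < alpha by exact: lt_trans a1.
move=> theta si sj Tt Qij i0 j0.
have := sig0 w; rewrite le_eqVlt => /predU1P[sw0|swpos].
  have DD : Delta0 = 0.
    have D2 : 0 <= Delta0 ^+ 2 * t by rewrite mulr_ge0 ?sqr_ge0// ltW.
    have S0 : 0 <= (\sum_(l < m) Dhat l w ^+ 2) / m%:R.
      by rewrite divr_ge0// ?(ltW mR0)// sumr_ge0// => l _; rewrite sqr_ge0.
    move: Ksig; rewrite -sw0 expr0n/= pmulr_rle0 ?divr_gt0 ?mulr_gt0// /K => K0.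
    (* [K] is a sum of two nonnegative terms and is at most 0; since [t] is positive, [Delta0]
       vanishes. *)
    have /eqP : Delta0 ^+ 2 * t = 0 by lra.
    by rewrite mulf_eq0 (gt_eqF t0) orbF sqrf_eq0 => /eqP.
  have mDi : measurable ([set si] `*` [set: X]) by exact: measurableX.
  have mDj : measurable ([set sj] `*` [set: X]) by exact: measurableX.
  have [nui nuiE] := cond_prob_exists mDi i0.
  have [nuj nujE] := cond_prob_exists mDj j0.
  rewrite /AveSD integral0_eq ?lee_fin ?(ltW e0)// => u su.
  have gN0 : is_gaussian PN (Nf (sigma w)) 0 by have := gN _ (sig0 w); rewrite -sw0.
  apply: (noiseless_renyi_eq0 mf ms gN0 _ nuiE nujE).
  by rewrite -[0%E]/(0%:E) -DD; apply: WinfDelta => //; exact: DeltaU.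
(* The family is used at the realised noise level [sigma w]. *)
pose k : {k | valid k} := exist valid (sigma w, theta, si, sj) (And5 swpos Tt Qij i0 j0).
have [_ _ _ _ hA] := hP k.
apply: le_trans hA _.
have sw20 : 0 < 2 * sigma w ^+ 2 by rewrite pmulr_rgt0 ?exprn_even_gt0 ?gt_eqF.
apply: (@le_trans _ _ ((alpha / (2 * sigma w ^+ 2))%:E * e%:E)%E).
  apply: lee_wpmul2l; first by rewrite lee_fin divr_ge0 ?(ltW al0) ?(ltW sw20).
  by rewrite fineK//; exact: gint.
rewrite -EFinM lee_fin mulrAC ler_pdivrMr//.
have : alpha * e <= alpha * K by rewrite ler_wpM2l// ltW.
move/le_trans; apply.
move: Ksig; rewrite mulrAC ler_pdivrMr ?mulr_gt0//; lra.
Qed.
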